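(* Let $p\ge 1$, let $X$ and $X'$ be $C^p$ Banach manifolds with boundary, let $f:X\to X'$ be a $C^p$ map, let $x_0'\in X'$ and let $x_0\in f^{-1}(x_0')$. If $f$ is a submersion at $x_0$, then there are a chart $(U,\varphi,(E,\lambda))$ for $X$ with $x_0\in U$ and $\varphi(x_0)=0$, such that the subspace $$K:=d\varphi(x_0)\left((df(x_0))^{-1}(0)\right)\subset E$$ is closed and has a closed complement in $E$ (let $\iota_K:K\to E$ be the continuous inclusion), and the map $$g:=\varphi^{-1}\circ\iota_K\restriction(\varphi(U)\cap K):\ \varphi(U)\cap K\to\varphi^{-1}(\varphi(U)\cap K)\subset X$$ is a $C^p$ embedding from the relatively open subset $\varphi(U)\cap K$ of $K\cap E_\lambda^+$ onto the $C^p$ Banach submanifold $\varphi^{-1}(\varphi(U)\cap K)$ of $X$. Moreover, the following hold: (1) $\varphi^{-1}(\varphi(U)\cap K)=U\cap f^{-1}(x_0')$; (2) $T_x(f^{-1}(x_0'))=(df(x))^{-1}(0)=(d\varphi(x))^{-1}K$ for all $x\in U\cap f^{-1}(x_0')$. Finally, if at every point $x\in f^{-1}(x_0')$ there is an open neighborhood $V_x$ of $x$ in $X$ such that $f(V_x\cap\partial X)\subset\partial X'$ and $f$ is a submersion at $x$, then $f^{-1}(x_0')$ is a $C^p$ Banach submanifold of $X$.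
   Context: Half spaces and differentiability: for a real Banach space $E$ and $\lambda$ either a nonzero continuous linear functional on $E$ or the constant function $1$ (this second choice accounts for manifolds without boundary), put $E_\lambda^+=\{x\in E:\lambda(x)\ge 0\}$. A map $h:U\to F$ from an open subset $U$ of $E_\lambda^+$ to a Banach space $F$ is differentiable at $x\in U$ if there is a bounded linear $u:E\to F$ (necessarily unique) with $\|h(y)-h(x)-u(y-x)\|_F/\|y-x\|_E\to 0$ as $y\to x$ in $U$; $C^p$ maps ($p\in\{1,2,\dots\}\cup\{\infty\}$) are defined accordingly. Manifolds: a $C^p$ Banach manifold with boundary is a set $X$ with a (maximal) $C^p$ atlas of charts $(U,\varphi,(E,\lambda))$, where $U\subset X$, and $\varphi:U\to E_\lambda^+$ is injective with image open in $E_\lambda^+$, and the chart changes are $C^p$. The boundary $\partial X$ is the set of points $x$ with $\lambda(\varphi(x))=0$ for some (equivalently any) chart at $x$. The tangent space $T_xX$ is isomorphic to $E$ for interior and for boundary points $x$. $C^p$ maps and their derivatives $df(x)$ are defined via charts. Submanifolds: a subset $Y\subset X$ is a $C^p$ submanifold if for every $y\in Y$ there are a chart $(U,\varphi,(E,\lambda))$ of $X$ with $y\in U$, $\varphi(y)=0$, a closed linear subspace $F\subset E$ with a closed complement in $E$, and $\mu$ (a continuous linear functional on $F$ or the constant $1$) such that $\varphi(U\cap Y)=\varphi(U)\cap F_\mu^+$ and this is an open subset of $F_\mu^+$. A $C^p$ embedding is a $C^p$ map whose image is a $C^p$ submanifold and which is a $C^p$ diffeomorphism onto its image. Submersion: a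 $C^p$ map $f:X\to X'$ is a submersion at $x\in X$ if (i) there is an open neighborhood $V_x\subset X$ of $x$ with $f(V_x\cap\partial X)\subset\partial X'$; (ii) $\operatorname{Ran}df(x)=T_{f(x)}X'$; and (iii) $\operatorname{Ker}df(x)$ has a closed complement in $T_xX$. *)

(* Defs.v *)
From HB Require Import structures.
From mathcomp Require Import all_boot all_order all_algebra.
From mathcomp Require Import all_classical all_reals all_analysis.

Set Implicit Arguments.
Unset Strict Implicit.
Unset Printing Implicit Defensive.

Import Order.TTheory GRing.Theory Num.Theory.
Import numFieldNormedType.Exports.

Local Open Scope classical_set_scope.
Local Open Scope ring_scope.

Section BoundedLinear.
Context {R : realType} (E F : normedModType R).

Definition blin_pred : {pred E -> F} :=
  fun f => `[< linear f /\ continuous f >].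

Record blin := Blin { blin_fun :> E -> F ; _ : blin_fun \in blin_pred }.

HB.instance Definition _ := [isSub for blin_fun].
HB.instance Definition _ := [Choice of blin by <:].

Lemma blin_linear (f : blin) : linear f.
Proof. by case: f => f /= /asboolP[]. Qed.

Lemma blin_continuous (f : blin) : continuous f.
Proof. by case: f => f /= /asboolP[]. Qed.

HB.instance Definition _ (f : blin) :=
  GRing.isLinear.Build R E F *:%R f (blin_linear f).

Lemma blin_submod_closed : subsemimod_closed blin_pred.
Proof.
split; first split.
- apply/asboolP; split=> [a x y|]; first by rewrite scaler0 addr0.
  by move=> x; exact: cvg_cst.
- move=> f g /asboolP[lf cf] /asboolP[lg cg]; apply/asboolP; split.
    by move=> a x y; rewrite !fctE lf lg scalerDr addrACA.
  by move=> x; exact: cvgD (cf x) (cg x).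
- move=> a f /asboolP[lf cf]; apply/asboolP; split.
    by move=> b x y; rewrite !fctE lf scalerDr !scalerA mulrC.
  by move=> x; exact: cvgZr (cf x).
Qed.

HB.instance Definition _ :=
  GRing.isSubmodClosed.Build R (E -> F) blin_pred blin_submod_closed.
HB.instance Definition _ := [SubChoice_isSubLmodule of blin by <:].

Definition opnorm (f : blin) : R := sup [set `|f x| | x in [set x | `|x| <= 1]].

Lemma blin_bound (f : blin) : exists2 M, 0 <= M & forall x, `|f x| <= M * `|x|.
Proof.
have /linear_bounded_continuous/linear_boundedP :
    continuous (f : {linear E -> F}).
  exact: blin_continuous.
move=> /pinfty_ex_gt0[M M0 fM]; exists M => //; exact: ltW.
Qed.

Lemma opnorm_has_sup (f : blin) :
  has_sup [set `|f x| | x in [set x | `|x| <= 1]].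
Proof.
split; first by exists `|f 0|, 0 => //=; rewrite normr0.
have [M M0 fM] := blin_bound f; exists M => _ [x /= x1 <-].
by rewrite (le_trans (fM x))// ler_piMr.
Qed.

Lemma le_opnorm (f : blin) x : `|f x| <= opnorm f * `|x|.
Proof.
have [->|x0] := eqVneq x 0; first by rewrite linear0 !normr0 mulr0.
have nx0 : 0 < `|x| by rewrite normr_gt0.
rewrite -ler_pdivrMr// mulrC.
apply: (ub_le_sup (opnorm_has_sup f).2).
exists (`|x|^-1 *: x) => /=.
  by rewrite normrZ normfV normr_id mulVf ?gt_eqF.
by rewrite linearZ/= normrZ normfV normr_id.
Qed.

Lemma opnorm_le (f : blin) M :
  (forall x, `|x| <= 1 -> `|f x| <= M) -> opnorm f <= M.
Proof.
move=> fM; apply: ge_sup; first exact: (opnorm_has_sup f).1.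
by move=> _ [x /= x1 <-]; exact: fM.
Qed.

Lemma opnorm_ge0 (f : blin) : 0 <= opnorm f.
Proof.
apply: (ub_le_sup (opnorm_has_sup f).2).
by exists 0 => /=; rewrite ?linear0 normr0.
Qed.

Lemma opnormD (f g : blin) : opnorm (f + g) <= opnorm f + opnorm g.
Proof.
apply: opnorm_le => x x1; rewrite (le_trans (ler_normD _ _))// lerD//.
  by rewrite (le_trans (le_opnorm _ _))// ler_piMr// opnorm_ge0.
by rewrite (le_trans (le_opnorm _ _))// ler_piMr// opnorm_ge0.
Qed.

Lemma opnormZ_le a (f : blin) : opnorm (a *: f) <= `|a| * opnorm f.
Proof.
apply: opnorm_le => x x1; rewrite normrZ ler_wpM2l//.
by rewrite (le_trans (le_opnorm _ _))// ler_piMr// opnorm_ge0.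
Qed.

Lemma opnormZ a (f : blin) : opnorm (a *: f) = `|a| * opnorm f.
Proof.
apply/eqP; rewrite eq_le opnormZ_le/=.
have [->|a0] := eqVneq a 0; first by rewrite normr0 mul0r opnorm_ge0.
rewrite -[in leLHS](scale1r f) -(mulVf a0) -scalerA.
rewrite -ler_pdivlMl ?normr_gt0// -normfV; exact: opnormZ_le.
Qed.

Lemma opnorm_eq0 (f : blin) : opnorm f = 0 -> f = 0.
Proof.
move=> f0; apply/val_inj/funext => x /=; apply/eqP.
by rewrite -normr_le0 (le_trans (le_opnorm f x))// f0 mul0r.
Qed.

HB.instance Definition _ :=
  Lmodule_isNormed.Build R blin opnormD opnormZ opnorm_eq0.

End BoundedLinear.


Section ClosedSubspace.
Context {R : realType} (E : completeNormedModType R).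

Record csubspace := CSubspace {
  cs_set :> set E ;
  cs_set0 : cs_set 0 ;
  cs_setD : forall a x y, cs_set x -> cs_set y -> cs_set (a *: x + y) ;
  cs_closed : closed cs_set }.

Context (K : csubspace).

(* K as a Banach space for the norm of E; a dedicated type because set_type
   already carries a pseudometric structure. *)
Record cs_type := CsElt { cs_val : E ; _ : cs_val \in cs_set K }.

HB.instance Definition _ := [isSub for cs_val].
HB.instance Definition _ := [Choice of cs_type by <:].

Lemma cs_submod_closed : subsemimod_closed (mem (cs_set K)).
Proof.
have h a x y : x \in cs_set K -> y \in cs_set K -> a *: x + y \in cs_set K.
  by move=> /set_mem Kx /set_mem Ky; apply/mem_set; exact: cs_setD.
have h0 : 0 \in cs_set K by apply/mem_set; exact: cs_set0.
split; first split=> //.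
- by move=> x y Kx Ky; rewrite -(scale1r x); exact: h.
- by move=> a x Kx; rewrite -[a *: x]addr0; exact: h.
Qed.

HB.instance Definition _ :=
  GRing.SubChoice_isSubLmodule.Build R E (mem (cs_set K)) cs_type
    cs_submod_closed.

Definition cs_norm (x : cs_type) : R := `|cs_val x|.

Lemma cs_normD x y : cs_norm (x + y) <= cs_norm x + cs_norm y.
Proof. exact: ler_normD. Qed.

Lemma cs_normZ a x : cs_norm (a *: x) = `|a| * cs_norm x.
Proof. exact: normrZ. Qed.

Lemma cs_norm_eq0 x : cs_norm x = 0 -> x = 0.
Proof. by move=> /normr0_eq0 x0; exact: val_inj. Qed.

HB.instance Definition _ :=
  Lmodule_isNormed.Build R cs_type cs_normD cs_normZ cs_norm_eq0.

Lemma cs_normE (x : cs_type) : `|x| = `|cs_val x|. Proof. by []. Qed.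

Lemma cs_complete (F : set_system cs_type) :
  ProperFilter F -> cauchy F -> cvg F.
Proof.
move=> FF Fc.
have vF : cvg (cs_val @ F).
  apply: cauchy_cvg; apply/cauchy_ballP => e e0.
  have /cauchy_ballP/(_ e e0) := Fc.
  case=> -[A B] [/= FA FB] AB.
  exists (cs_val @` A, cs_val @` B) => /=.
    split; rewrite nbhs_simpl/=.
      by apply: filterS FA => x Ax; exists x.
    by apply: filterS FB => x Bx; exists x.
  case=> _ _ [/= [a Aa <-] [b Bb <-]].
  by have := AB (a, b) (conj Aa Bb); rewrite -!ball_normE.
have Kl : lim (cs_val @ F) \in cs_set K.
  apply/mem_set; apply: (closed_cvg _ (@cs_closed K)) vF => //.
  by apply: nearW => -[x /= /set_mem].
apply/cvg_ex; exists (CsElt Kl); apply/cvgrPdist_lt => e e0.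
by move/cvgrPdist_lt : vF => /(_ e e0).
Qed.

HB.instance Definition _ := Uniform_isComplete.Build cs_type cs_complete.

End ClosedSubspace.

Definition has_closed_complement (R : realType) (E : completeNormedModType R)
    (A : set E) : Prop :=
  exists G : csubspace E,
    A `&` G = [set 0] /\ [set a + g | a in A & g in G] = setT.

Section Differentiability.
Context {R : realType}.

(* The punctured filter makes the quotient meaningful; in the applications W is
   relatively open in a half space, so u is unique. *)
Definition is_deriv (E F : normedModType R) (W : set E) (h : E -> F) (x : E)
    (u : blin E F) : Prop :=
  (fun y => `|h y - h x - u (y - x)| / `|y - x|) @ within W x^' --> (0 : R).

Definition deriv (E F : normedModType R) (W : set E) (h : E -> F) (x : E) :
    blin E F :=
  xget 0 [set u | is_deriv W h x u].

Fixpoint Cn_on (n : nat) (E F : normedModType R) (W : set E) (h : E -> F) :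
    Prop :=
  match n with
  | 0 => {within W, continuous h}
  | m.+1 => exists h' : E -> blin E F,
      (forall x, W x -> is_deriv W h x (h' x)) /\ Cn_on m W h'
  end.

(* None stands for p = oo. *)
Definition Cp_on (p : option nat) (E F : normedModType R) (W : set E)
    (h : E -> F) : Prop :=
  if p is Some n then Cn_on n W h else forall n, Cn_on n W h.

Definition functional (E : normedModType R) (l : E -> R) : Prop :=
  scalar l /\ continuous l.

Definition half_form (E : normedModType R) (l : E -> R) : Prop :=
  (functional l /\ exists x, l x != 0) \/ l = cst 1.

Definition halfspace (E : normedModType R) (l : E -> R) : set E :=
  [set x | 0 <= l x].

Definition rel_open (E : normedModType R) (H W : set E) : Prop :=
  exists2 O, open O & W = H `&` O.

End Differentiability.

(* The data (U, phi, (E, lambda)) of a chart. [chart_inv] is the inverse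
   phi^-1 : phi(U) -> U; it is arbitrary outside phi(U), as [chart_map] is
   outside U. *)
Record prechart (R : realType) (X : Type) := Chart {
  chart_model : completeNormedModType R ;
  chart_form : chart_model -> R ;
  chart_dom : set X ;
  chart_map : X -> chart_model ;
  chart_inv : chart_model -> X }.
Arguments chart_form {R X} c _ : rename.
Arguments chart_inv {R X} c _ : rename.

Section Charts.
Context {R : realType}.

Definition chart_image (X : Type) (c : prechart R X) : set (chart_model c) :=
  chart_map c @` chart_dom c.

Definition chart_half (X : Type) (c : prechart R X) : set (chart_model c) :=
  halfspace (chart_form c).

Arguments chart_image {X} c _.
Arguments chart_half {X} c _.

Definition is_chart (X : Type) (c : prechart R X) : Prop :=
  [/\ half_form (chart_form c),
      forall x, chart_dom c x -> chart_inv c (chart_map c x) = x &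
      rel_open (chart_half c) (chart_image c)].

(* Conditions on the chart change from c to d only. *)
Definition Cp_change (p : option nat) (X : Type) (c d : prechart R X) : Prop :=
  rel_open (chart_half c) (chart_map c @` (chart_dom c `&` chart_dom d)) /\
  Cp_on p (chart_map c @` (chart_dom c `&` chart_dom d))
    (chart_map d \o chart_inv c).

Definition compatible (p : option nat) (X : Type) (c d : prechart R X) : Prop :=
  Cp_change p c d /\ Cp_change p d c.

(* [prechart R X] lives in a larger universe than the model spaces, hence
   families of charts are plain predicates. *)
Definition chart_family (X : Type) := prechart R X -> Prop.

Record is_maximal_atlas (p : option nat) (X : Type) (A : chart_family X) :
    Prop := IsMaximalAtlas {
  atlas_chart : forall c, A c -> is_chart c ;
  atlas_cover : forall x, exists c, A c /\ chart_dom c x ;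
  atlas_compat : forall c d, A c -> A d -> compatible p c d ;
  atlas_max : forall c, is_chart c ->
    (forall d, A d -> compatible p c d) -> A c }.

(* The maximal atlas generated by a family of charts. *)
Definition saturate (p : option nat) (X : Type) (A : chart_family X) :
    chart_family X :=
  fun c => is_chart c /\ forall d, A d -> compatible p c d.

Definition Cp_map (p : option nat) (X X' : Type) (A : chart_family X)
    (A' : chart_family X') (f : X -> X') : Prop :=
  forall x, exists c d,
    [/\ A c, A' d, chart_dom c x, chart_dom c `<=` f @^-1` chart_dom d &
        Cp_on p (chart_image c) (chart_map d \o f \o chart_inv c)].

Definition diffeo (p : option nat) (X X' : Type) (A : chart_family X)
    (A' : chart_family X') (f : X -> X') : Prop :=
  Cp_map p A A' f /\
  exists h, [/\ cancel f h, cancel h f & Cp_map p A' A h].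

(* The derivative at x of f, read in the charts c at x and d at f x. *)
Definition deriv_in (X X' : Type) (c : prechart R X) (d : prechart R X')
    (f : X -> X') (x : X) : blin (chart_model c) (chart_model d) :=
  deriv (chart_map c @` (chart_dom c `&` f @^-1` chart_dom d))
    (chart_map d \o f \o chart_inv c) (chart_map c x).

(* The relatively open subset W of the half space {0 <= l} of E, seen as a
   manifold with the inclusion as its only generating chart. *)
Definition open_charts (E : completeNormedModType R) (l : E -> R) (W : set E) :
    chart_family W :=
  fun d => is_chart d /\ exists psi : E -> W, d = Chart l setT set_val psi.

End Charts.
Arguments chart_image {R X} c _.
Arguments chart_half {R X} c _.
Arguments open_charts {R E} l W _.
Arguments chart_family : clear implicits.

Record manifold (R : realType) (p : option nat) := Manifold {
  point_set :> Type ;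
  atlas : chart_family R point_set ;
  atlasP : is_maximal_atlas p atlas }.

Section Manifolds.
Context {R : realType} {p : option nat}.
Implicit Types X : manifold R p.

Definition mopen X (V : set X) : Prop :=
  forall c, atlas c ->
    rel_open (chart_half c) (chart_map c @` (V `&` chart_dom c)).

Definition boundary X : set X :=
  [set x | exists c : prechart R X,
    [/\ atlas c, chart_dom c x & chart_form c (chart_map c x) = 0]].
Arguments boundary X _ : clear implicits.

Definition chart_at X (x : X) : prechart R X :=
  projT1 (cid (atlas_cover (atlasP X) x)).

(* A tangent vector at x is a class of pairs (chart c at x, vector of
   chart_model c) modulo the derivatives of the chart changes; each class has a
   unique representative in the chosen chart [chart_at x]. *)
Definition tangent X (x : X) : completeNormedModType R :=
  chart_model (chart_at x).

Definition dmap X (X' : manifold R p) (f : X -> X') (x : X) :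
    blin (tangent x) (tangent (f x)) :=
  deriv_in (chart_at x) (chart_at (f x)) f x.

Definition dchart X (c : prechart R X) (x : X) :
    blin (tangent x) (chart_model c) :=
  deriv_in (chart_at x) c id x.

Definition dker X (X' : manifold R p) (f : X -> X') (x : X) : set (tangent x) :=
  [set v | dmap f x v = 0].
Arguments dker {X X'} f x _.

Definition maps_boundary_near X (X' : manifold R p) (f : X -> X') (x : X) :
    Prop :=
  exists V : set X,
    [/\ mopen V, V x & f @` (V `&` boundary X) `<=` boundary X'].

Definition submersion X (X' : manifold R p) (f : X -> X') (x : X) : Prop :=
  [/\ maps_boundary_near f x,
      range (dmap f x) = setT &
      has_closed_complement (dker f x)].

Definition slice_chart X (Y : set X) (y : X) (c : prechart R X)
    (F : csubspace (chart_model c)) (mu : cs_type F -> R) : Prop :=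
  [/\ atlas c, chart_dom c y, chart_map c y = 0, has_closed_complement F &
      chart_map c @` (chart_dom c `&` Y) =
        chart_image c `&` (@cs_val _ _ F @` halfspace mu) /\
      rel_open (halfspace mu)
        [set k | chart_image c (cs_val k) /\ halfspace mu k]].

Definition submanifold X (Y : set X) : Prop :=
  forall y, Y y -> exists c F (mu : cs_type F -> R),
    (functional mu \/ mu = cst 1) /\ @slice_chart X Y y c F mu.

(* The restriction to Y of the slice charts. As mu = 0 and mu = 1 give the same
   half space, the half_form condition excludes no slice. *)
Definition sub_charts X (Y : set X) : chart_family R Y :=
  fun d => is_chart d /\
    exists y c F (mu : cs_type F -> R) phi psi,
      [/\ Y y, @slice_chart X Y y c F mu,
          forall z : Y, chart_dom c (set_val z) ->
            cs_val (phi z) = chart_map c (set_val z) &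
          d = Chart mu [set z : Y | chart_dom c (set_val z)] phi psi].
Arguments sub_charts {X} Y _.

Definition sub_atlas X (Y : set X) : chart_family R Y :=
  saturate p (sub_charts Y).
Arguments sub_atlas {X} Y _.

(* T_x Y as a subspace of T_x X: the range of the derivative at x of the
   inclusion of Y into X. *)
Definition sub_tangent X (Y : set X) (x : X) : set (tangent x) :=
  [set v | exists (d : prechart R Y) (z : Y),
    [/\ sub_charts Y d, chart_dom d z, set_val z = x &
        range (deriv_in d (chart_at x) set_val z) v]].

Definition corestr (M : Type) X (g : M -> X) (m : M) : range g :=
  exist _ (g m) (mem_set (imageT g m)).

Definition embedding (M : Type) (A : chart_family R M) X (g : M -> X) : Prop :=
  [/\ Cp_map p A (@atlas R p X) g,
      submanifold (range g) &
      diffeo p A (sub_atlas (range g)) (corestr g)].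

End Manifolds.
Arguments boundary {R p} X _.
Arguments dker {R p X X'} f x _.
Arguments sub_charts {R p X} Y _.
Arguments sub_atlas {R p X} Y _.
Arguments sub_tangent {R p X} Y x _.

(* The restriction of l to K, or 1 if it vanishes, so that in all cases its
   half space is the intersection of K with that of l. *)
Definition restr_half (R : realType) (E : completeNormedModType R) (l : E -> R)
    (K : csubspace E) : cs_type K -> R :=
  if `[< forall k : cs_type K, l (cs_val k) = 0 >] then cst 1
  else fun k => l (cs_val k).
Arguments restr_half {R E} l K _.

(* Main.v *)
(* Read in charts at x0 and f x0, the map f becomes F : W -> E' with W relatively
   open in the half space {l >= 0}, and u = F'(x0) is onto with complemented
   kernel K.  The open mapping theorem gives a bounded right inverse B of u, and
   P = id - B u projects onto K.  The map
     Phi z = P (z - z0) + B (F z - F z0)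
   has derivative id at z0 and satisfies u (Phi z) = F z - F z0, so in the
   coordinates Phi the map f is affine with linear part u, and its fibre is K.
   At a boundary point, f maps the boundary into the boundary; hence l' o u
   vanishes on ker l, where l' is the form of the target chart, and is a positive
   multiple of l.  Therefore l vanishes on K, and l o Phi is a positive multiple
   of l' o F: Phi preserves the half space and its boundary, and the inverse
   function theorem holds for such maps. *)

From HB Require Import structures.
Require Import Defs.
From mathcomp Require Import all_boot all_order all_algebra.
From mathcomp Require Import all_classical all_reals all_analysis.
From mathcomp Require Import ring lra.
Set Implicit Arguments.
Unset Strict Implicit.
Unset Printing Implicit Defensive.
Import Order.TTheory GRing.Theory Num.Theory.
Import numFieldNormedType.Exports.
Local Open Scope classical_set_scope.
Local Open Scope ring_scope.

(** The form of a chart restricts the choice of coordinates. A chart sending an interior point to 0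
    cannot keep a nonconstant form, because linear forms vanish at 0 and the point would become a
    boundary point. At an interior point the chart is therefore first cut down to the part where its
    form is positive and given the form [1]. At a boundary point [x0], [f x0] is a boundary point
    too, so the target form is a nonzero functional, and its factor relative to the source form is
    nonzero because [u] is onto. In both cases the kernel lies in the half space, so the fibre is
    modelled on open subsets of the whole kernel. The order of smoothness is a recursion through
    derivatives with values in operator spaces. The inductions for sums, products and composites
    must hence range over all target spaces, and composites and operator inverses are reduced to
    bounded bilinear maps. Infinite order comes with the finite ones, since the neighbourhood found
    by the inverse function theorem does not depend on the order. *)

Section AbelianIdentities.
Variable V : zmodType.

(** Vector identities are decided by reflection: both sides become integer combinations of their
    atoms, and the coefficients are compared by computation. *)
Inductive zexpr := ZVar of nat | ZZero | ZAdd of zexpr & zexpr | ZOpp of zexpr.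

Fixpoint zeval (env : seq V) (t : zexpr) : V :=
  match t with
  | ZVar i => nth 0 env i
  | ZZero => 0
  | ZAdd a b => zeval env a + zeval env b
  | ZOpp a => - zeval env a
  end.

Fixpoint zcoef (t : zexpr) (i : nat) : int :=
  match t with
  | ZVar j => (i == j)%:R
  | ZZero => 0
  | ZAdd a b => zcoef a i + zcoef b i
  | ZOpp a => - zcoef a i
  end.

(** Variables beyond the environment evaluate to the default 0, so the sum over the environment
    loses nothing. *)
Lemma zevalE env t :
  zeval env t = \sum_(i < size env) env`_i *~ zcoef t i.
Proof.
elim: t => [j||a IHa b IHb|a IHa] /=.
- have [js|sj] := ltnP j (size env).
    rewrite (bigD1 (Ordinal js))//= eqxx big1 ?addr0// => i ij.
    by rewrite -val_eqE/= in ij; rewrite (negbTE ij).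
  rewrite nth_default// big1// => i _.
  by rewrite ltn_eqF// (leq_trans _ sj).
- by rewrite big1.
- by rewrite IHa IHb -big_split; apply: eq_bigr => i _; rewrite mulrzDr.
- by rewrite IHa -sumrN; apply: eq_bigr => i _; rewrite mulrNz.
Qed.

Lemma zeval_eq env s t :
  all (fun i => zcoef s i == zcoef t i) (iota 0 (size env)) ->
  zeval env s = zeval env t.
Proof.
move=> /allP st; rewrite !zevalE; apply: eq_bigr => i _.
by rewrite (eqP (st _ _))// mem_iota/=.
Qed.

End AbelianIdentities.

Ltac zmod_mem x env :=
  match env with
  | nil => constr:(false)
  | cons ?y _ => let _ := constr:(erefl x : x = y) in constr:(true)
  | cons _ ?e => zmod_mem x e
  end.
Ltac zmod_env t env :=
  lazymatch t with
  | @GRing.add _ ?a ?b => let env := zmod_env a env in zmod_env b env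
  | @GRing.opp _ ?a => zmod_env a env
  | @GRing.zero _ => env
  | _ => lazymatch zmod_mem t env with
         | true => env
         | false => constr:(cons t env)
         end
  end.
Ltac zmod_index t env :=
  match env with
  | cons ?y _ => let _ := constr:(erefl t : t = y) in constr:(0%N)
  | cons _ ?e => let i := zmod_index t e in constr:(S i)
  end.
Ltac zmod_reify t env :=
  lazymatch t with
  | @GRing.add _ ?a ?b =>
      let a := zmod_reify a env in let b := zmod_reify b env in
      constr:(ZAdd a b)
  | @GRing.opp _ ?a => let a := zmod_reify a env in constr:(ZOpp a)
  | @GRing.zero _ => constr:(ZZero)
  | _ => let i := zmod_index t env in constr:(ZVar i)
  end.

(* Atoms are compared up to conversion: elaboration inserts coercions in
   syntactically different ways. *)
Ltac zmod :=
  rewrite ?/reverse_coercion;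
  lazymatch goal with
  | |- @eq ?T ?x ?y =>
      let e0 := constr:(@nil T) in
      let e1 := zmod_env x e0 in
      let env := zmod_env y e1 in
      let s := zmod_reify x env in
      let t := zmod_reify y env in
      exact: (@zeval_eq _ env s t isT)
  end.

(** * Bounded linear and bilinear maps *)

Section BoundedLinearMaps.
Context {R : realType}.
Implicit Types E F G H : normedModType R.

Lemma blin_predP E F (f : E -> F) :
  linear f -> (exists M, forall x, `|f x| <= M * `|x|) -> f \in @blin_pred R E F.
Proof.
move=> lf [M fM]; apply/asboolP; split => //.
pose h := GRing.isLinear.Build R E F *:%R f lf.
pose f' : {linear E -> F} := HB.pack f h.
have : continuous f'.
  apply/linear_bounded_continuous/linear_boundedP.
  exists M; split; first exact: num_real.
  by move=> r Mr x; rewrite (le_trans (fM x))// ler_wpM2r// ltW.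
by [].
Qed.

Lemma blinP E F (u v : blin E F) : (forall x, u x = v x) -> u = v.
Proof. by move=> uv; apply/val_inj/funext. Qed.

Lemma blinDE E F (u v : blin E F) x : (u + v) x = u x + v x.
Proof. by []. Qed.

Lemma blinNE E F (u : blin E F) x : (- u) x = - u x.
Proof. by []. Qed.

Lemma blinBE E F (u v : blin E F) x : (u - v) x = u x - v x.
Proof. by []. Qed.

Lemma blinZE E F a (u : blin E F) x : (a *: u) x = a *: u x.
Proof. by []. Qed.

Lemma ler_blin E F (u : blin E F) x : `|u x| <= `|u| * `|x|.
Proof. exact: le_opnorm. Qed.

Lemma ler_blin_le E F (u : blin E F) x a b :
  `|u| <= a -> `|x| <= b -> `|u x| <= a * b.
Proof. by move=> ua xb; rewrite (le_trans (ler_blin u x))// ler_pM. Qed.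

Lemma blin_norm_le E F (u : blin E F) M : 0 <= M ->
  (forall x, `|u x| <= M * `|x|) -> `|u| <= M.
Proof.
move=> M0 uM; apply: opnorm_le => x x1; rewrite (le_trans (uM x))//.
by rewrite ler_piMr.
Qed.

Lemma blin_comp_subproof E F G (g : blin F G) (f : blin E F) :
  (fun x => g (f x)) \in @blin_pred R E G.
Proof.
apply: blin_predP => [a x y|]; first by rewrite !linearP.
exists (`|g| * `|f|) => x; rewrite (le_trans (ler_blin _ _))// -mulrA.
by rewrite ler_wpM2l// ler_blin.
Qed.

Definition blin_comp E F G (g : blin F G) (f : blin E F) : blin E G :=
  Blin (blin_comp_subproof g f).

Lemma blin_id_subproof E : (fun x : E => x) \in @blin_pred R E E.
Proof. by apply: blin_predP => //; exists 1 => x; rewrite mul1r. Qed.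

Definition blin_id E : blin E E := Blin (blin_id_subproof E).

(* Bounded bilinear maps; [bbilL] and [bbilR] are the two terms of Leibniz'
   rule, which are again bounded bilinear: this closes the induction on the
   order of differentiability. *)
Record bbil F1 F2 G := BBil {
  bbil_fun :> F1 -> F2 -> G ;
  bbil_linl : forall y, linear (bbil_fun^~ y) ;
  bbil_linr : forall x, linear (bbil_fun x) ;
  bbil_bound : exists2 M, 0 <= M &
    forall x y, `|bbil_fun x y| <= M * `|x| * `|y| }.

Lemma bbilL_subproof E F1 F2 G (B : bbil F1 F2 G) (u : blin E F1) (y : F2) :
  (fun h => B (u h) y) \in @blin_pred R E G.
Proof.
apply: blin_predP => [a x z|]; first by rewrite linearP bbil_linl.
have [M M0 BM] := bbil_bound B; exists (M * `|u| * `|y|) => x.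
rewrite (le_trans (BM _ _))// -!mulrA ler_wpM2l// [leRHS]mulrC -mulrA [leLHS]mulrC.
by rewrite ler_wpM2l// mulrC ler_blin.
Qed.

Lemma bbilR_subproof E F1 F2 G (B : bbil F1 F2 G) (x : F1) (v : blin E F2) :
  (fun h => B x (v h)) \in @blin_pred R E G.
Proof.
apply: blin_predP => [a y z|]; first by rewrite linearP bbil_linr.
have [M M0 BM] := bbil_bound B; exists (M * `|x| * `|v|) => y.
rewrite (le_trans (BM _ _))// -!mulrA ler_wpM2l// ler_wpM2l//.
exact: ler_blin.
Qed.

Lemma bbilL_proof E F1 F2 G (B : bbil F1 F2 G) :
  let f (u : blin E F1) (y : F2) : blin E G := Blin (bbilL_subproof B u y) in
  [/\ forall y, linear (f^~ y), forall x, linear (f x) &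
      exists2 M, 0 <= M & forall x y, `|f x y| <= M * `|x| * `|y| ].
Proof.
split=> [y a u v|u a y z|].
- by apply: blinP => h /=; rewrite bbil_linl.
- by apply: blinP => h /=; rewrite bbil_linr.
- have [M M0 BM] := bbil_bound B; exists M => // u y.
  apply: blin_norm_le => [|x /=]; first by rewrite !mulr_ge0.
  rewrite (le_trans (BM _ _))// -!mulrA ler_wpM2l// [X in _ <= _ * X]mulrC mulrA.
  by rewrite ler_wpM2r// ler_blin.
Qed.

Definition bbilL E F1 F2 G (B : bbil F1 F2 G) :
    bbil (blin E F1) F2 (blin E G) :=
  let: And3 l r b := bbilL_proof E B in BBil l r b.

Lemma bbilR_proof E F1 F2 G (B : bbil F1 F2 G) :
  let f (x : F1) (v : blin E F2) : blin E G := Blin (bbilR_subproof B x v) in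
  [/\ forall y, linear (f^~ y), forall x, linear (f x) &
      exists2 M, 0 <= M & forall x y, `|f x y| <= M * `|x| * `|y| ].
Proof.
split=> [v a x y|x a u v|].
- by apply: blinP => h /=; rewrite bbil_linl.
- by apply: blinP => h /=; rewrite bbil_linr.
- have [M M0 BM] := bbil_bound B; exists M => // x v.
  apply: blin_norm_le => [|y /=]; first by rewrite !mulr_ge0.
  by rewrite (le_trans (BM _ _))// -!mulrA !ler_wpM2l// ler_blin.
Qed.

Definition bbilR E F1 F2 G (B : bbil F1 F2 G) :
    bbil F1 (blin E F2) (blin E G) :=
  let: And3 l r b := bbilR_proof E B in BBil l r b.

(** [bbilL] matches on an opaque proof, so its values are not reached by conversion; destructing
    that proof exposes them. *)
Lemma bbilLE E F1 F2 G (B : bbil F1 F2 G) (u : blin E F1) y h :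
  bbilL E B u y h = B (u h) y.
Proof. by rewrite /bbilL; case: bbilL_proof. Qed.

Lemma bbilRE E F1 F2 G (B : bbil F1 F2 G) x (v : blin E F2) h :
  bbilR E B x v h = B x (v h).
Proof. by rewrite /bbilR; case: bbilR_proof. Qed.

Lemma blin_comp_proof E F G :
  let f := @blin_comp E F G in
  [/\ forall y, linear (f^~ y), forall x, linear (f x) &
      exists2 M, 0 <= M & forall x y, `|f x y| <= M * `|x| * `|y| ].
Proof.
split=> [f a g h|g a f h|].
- exact: blinP.
- by apply: blinP => x /=; rewrite linearP.
- exists 1 => // g f; rewrite mul1r.
  apply: blin_norm_le => [|x /=]; first by rewrite mulr_ge0.
  by rewrite (le_trans (ler_blin _ _))// -mulrA ler_wpM2l// ler_blin.
Qed.

(** As a bounded bilinear map, composition makes the derivatives of composites and of operator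
    inverses bilinear expressions, to which [Cn_on_bbil] applies. *)
Definition bbil_comp E F G : bbil (blin F G) (blin E F) (blin E G) :=
  let: And3 l r b := blin_comp_proof E F G in BBil l r b.

Lemma bbil_compE E F G (g : blin F G) (f : blin E F) :
  bbil_comp E F G g f = blin_comp g f.
Proof. by rewrite /bbil_comp; case: blin_comp_proof. Qed.

Lemma bbilBl F1 F2 G (B : bbil F1 F2 G) x x' y : B (x - x') y = B x y - B x' y.
Proof.
by rewrite addrC -scaleN1r bbil_linl scaleN1r addrC.
Qed.

Lemma bbilBr F1 F2 G (B : bbil F1 F2 G) x y y' : B x (y - y') = B x y - B x y'.
Proof.
by rewrite addrC -scaleN1r bbil_linr scaleN1r addrC.
Qed.

End BoundedLinearMaps.

(** * Differential calculus on subsets of normed spaces *)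

Section Calculus.
Context {R : realType}.
Implicit Types E F G H : normedModType R.

(** Clearing the denominator also admits [y = x], where both sides vanish, so no punctured
    neighbourhood has to be carried along. *)
Lemma is_derivP E F (W : set E) (h : E -> F) x (u : blin E F) :
  is_deriv W h x u <-> forall e, 0 < e -> exists2 d, 0 < d &
    forall y, W y -> `|y - x| < d ->
      `|h y - h x - u (y - x)| <= e * `|y - x|.
Proof.
split=> [/cvgrPdist_le hu e e0|hu].
  have /nbhs_normP[d /= d0 hd] := hu e e0; exists d => // y Wy yxd.
  have [->|yx] := eqVneq y x.
    by rewrite !subrr linear0 subrr !normr0 mulr0.
  have := hd y; rewrite /ball_ /= distrC => /(_ yxd yx Wy).
  by rewrite sub0r normrN ger0_norm ?divr_ge0// ler_pdivrMr ?normr_gt0 ?subr_eq0.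
apply/cvgrPdist_le => e e0; have [d d0 hd] := hu e e0.
apply/nbhs_normP; exists d => //= y; rewrite /ball_ /= distrC => yd yx Wy.
rewrite sub0r normrN ger0_norm ?divr_ge0// ler_pdivrMr ?normr_gt0 ?subr_eq0//.
exact: hd.
Qed.

Lemma within_contP E F (W : set E) (h : E -> F) :
  {within W, continuous h} <-> forall x, W x -> forall e, 0 < e ->
    exists2 d, 0 < d & forall y, W y -> `|y - x| < d -> `|h y - h x| < e.
Proof.
rewrite subspace_continuousP; split=> [hc x Wx e e0|hc x Wx].
  have /cvgrPdist_lt/(_ e e0)/nbhs_normP[d /= d0 hd] := hc x Wx.
  exists d => // y Wy; rewrite distrC => yd.
  by rewrite distrC; exact: hd.
apply/cvgrPdist_lt => e e0; have [d d0 hd] := hc x Wx e e0.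
apply/nbhs_normP; exists d => //= y; rewrite /ball_ /= distrC => yd Wy.
by rewrite distrC; exact: hd.
Qed.

Lemma rel_openP E (H W : set E) : rel_open H W <->
  (W `<=` H) /\ forall x, W x -> exists2 d, 0 < d &
    forall y, H y -> `|y - x| < d -> W y.
Proof.
split=> [[U oU ->]|[WH hW]].
  split=> [x []//|x [Hx Ux]].
  have /nbhs_normP[d /= d0 hd] : nbhs x U by exact: open_nbhs_nbhs.
  exists d => // y Hy yx; split=> //; apply: hd.
  by rewrite /ball_ /= distrC.
(* The open set is the union of the balls centred in [W] inside which [W] fills [H]. *)
exists [set x | exists y d, [/\ W y, `|x - y| < d &
    forall z, H z -> `|z - y| < d -> W z]].
  rewrite openE => x [y [d [Wy xyd hd]]] /=.
  apply/nbhs_normP; exists (d - `|x - y|); rewrite /= ?subr_gt0// => z.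
  rewrite /ball_ /= => xz; exists y, d; split=> //.
  rewrite -(subrK x z) -addrA (le_lt_trans (ler_normD _ _))//.
  by rewrite distrC -ltrBrDr.
apply/seteqP; split=> x.
  move=> Wx; split; first exact: WH.
  by have [d d0 hd] := hW x Wx; exists x, d; split=> //; rewrite subrr normr0.
by move=> [Hx [y [d [Wy xy hd]]]]; exact: hd.
Qed.

Lemma is_deriv_ext E F (W : set E) (h k : E -> F) x u :
  W x -> (forall y, W y -> h y = k y) -> is_deriv W h x u -> is_deriv W k x u.
Proof.
move=> Wx hk /is_derivP hu; apply/is_derivP => e /hu[d d0 hd].
by exists d => // y Wy yx; rewrite -!hk//; exact: hd.
Qed.

Lemma is_deriv_sub E F (W V : set E) (h : E -> F) x u :
  V `<=` W -> is_deriv W h x u -> is_deriv V h x u.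
Proof.
move=> VW /is_derivP hu; apply/is_derivP => e /hu[d d0 hd].
by exists d => // y /VW Wy; exact: hd.
Qed.

Lemma is_deriv_lip E F (W : set E) (h : E -> F) x u : is_deriv W h x u ->
  exists2 d, 0 < d & forall y, W y -> `|y - x| < d ->
    `|h y - h x| <= (`|u| + 1) * `|y - x|.
Proof.
move=> /is_derivP/(_ 1 ltr01)[d d0 hd]; exists d => // y Wy yx.
rewrite -(subrK (u (y - x)) (h y - h x)) (le_trans (ler_normD _ _))//.
by rewrite mulrDl addrC lerD ?ler_blin// hd.
Qed.

Lemma is_deriv_cont E F (W : set E) (h : E -> F) x u : is_deriv W h x u ->
  forall e, 0 < e -> exists2 d, 0 < d &
    forall y, W y -> `|y - x| < d -> `|h y - h x| < e.
Proof.
move=> /is_deriv_lip[d d0 hd] e e0; have M0 : 0 < `|u| + 1 by rewrite ltr_wpDl.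
exists (Num.min d (e / (`|u| + 1))); first by rewrite lt_min d0 divr_gt0.
move=> y Wy; rewrite lt_min => /andP[yd ye].
by rewrite (le_lt_trans (hd y Wy yd))// mulrC -ltr_pdivlMr.
Qed.

Lemma is_deriv_blin E F (W : set E) (u : blin E F) x : is_deriv W u x u.
Proof.
apply/is_derivP => e e0; exists 1 => // y _ _.
by rewrite -!linearB/= subrr linear0 normr0 mulr_ge0// ltW.
Qed.

Lemma is_deriv_cst E F (W : set E) (b : F) x : is_deriv W (cst b) x 0.
Proof.
apply/is_derivP => e e0; exists 1 => // y _ _.
by rewrite /cst subrr sub0r normrN normr0 mulr_ge0// ltW.
Qed.

Lemma is_derivD E F (W : set E) (h k : E -> F) x u v :
  is_deriv W h x u -> is_deriv W k x v ->
  is_deriv W (fun y => h y + k y) x (u + v).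
Proof.
move=> /is_derivP hu /is_derivP kv; apply/is_derivP => e e0.
have e2 : 0 < e / 2 by rewrite divr_gt0.
have [d d0 hd] := hu _ e2; have [d' d0' hd'] := kv _ e2.
exists (Num.min d d'); first by rewrite lt_min d0.
move=> y Wy; rewrite lt_min => /andP[yd yd'].
rewrite (_ : _ - _ = (h y - h x - u (y - x)) + (k y - k x - v (y - x))).
  rewrite (le_trans (ler_normD _ _))// [e]splitr mulrDl lerD ?hd ?hd'//.
by rewrite blinDE; zmod.
Qed.

Lemma is_deriv_comp E F G (W : set E) (V : set F) (f : E -> F) (g : F -> G)
    x u v :
  W x -> (forall y, W y -> V (f y)) ->
  is_deriv W f x u -> is_deriv V g (f x) v ->
  is_deriv W (g \o f) x (blin_comp v u).
Proof.
move=> Wx WV fu gv; apply/is_derivP => e e0.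
have [d1 d10 lip] := is_deriv_lip fu.
have M0 : 0 < `|u| + 1 by rewrite ltr_wpDl.
have N0 : 0 < `|v| + 1 by rewrite ltr_wpDl.
(* Half of [e] pays for the remainder of [g], scaled by the Lipschitz bound [|u| + 1] of [f] at [x];
   the other half pays for the remainder of [f], scaled by [|v|]. The 1 in [|v| + 1] keeps the
   divisor positive. *)
have [d2 d20 hg] := (is_derivP _ _ _ _).1 gv (e / 2 / (`|u| + 1))
  (divr_gt0 (divr_gt0 e0 (ltr0Sn _ _)) M0).
have [d3 d30 hf] := (is_derivP _ _ _ _).1 fu (e / 2 / (`|v| + 1))
  (divr_gt0 (divr_gt0 e0 (ltr0Sn _ _)) N0).
have [d4 d40 hc] := is_deriv_cont fu d20.
exists (Num.min (Num.min d1 d3) d4); first by rewrite !lt_min d10 d30.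
move=> y Wy; rewrite !lt_min => /andP[/andP[y1 y3] y4] /=.
rewrite -(subrK (v (f y - f x)) (g (f y) - g (f x))) -addrA -linearB.
rewrite (le_trans (ler_normD _ _))// [e]splitr mulrDl lerD//.
  rewrite (le_trans (hg _ (WV _ Wy) (hc _ Wy y4)))// mulrAC ler_pdivrMr//.
  rewrite -[leRHS]mulrA ler_wpM2l// ?divr_ge0// ?(ltW e0)//.
  by rewrite [leRHS]mulrC lip.
rewrite (le_trans (ler_blin _ _))//.
rewrite (@le_trans _ _ ((`|v| + 1) * `|f y - f x - u (y - x)|))//.
  by rewrite ler_wpM2r// lerDl.
by rewrite mulrC -ler_pdivlMr// (le_trans (hf _ Wy y3))// mulrAC.
Qed.

Lemma is_deriv_bbil E F1 F2 G (B : bbil F1 F2 G) (W : set E) (f : E -> F1)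
    (g : E -> F2) x u v :
  is_deriv W f x u -> is_deriv W g x v ->
  is_deriv W (fun y => B (f y) (g y)) x (bbilL E B u (g x) + bbilR E B (f x) v).
Proof.
move=> fu gv; apply/is_derivP => e e0.
have [M M0 BM] := bbil_bound B.
(* [C] serves the two terms that contain a derivative remainder; [C2] below serves the product of
   the two increments. Each of the three terms receives [e / 3]. *)
pose C := M * (`|u| + `|f x| + `|g x|) + 1.
have C0 : 0 < C by rewrite ltr_wpDl// mulr_ge0// !addr_ge0.
pose e' := Num.min 1 (e / 3 / C).
have e'0 : 0 < e' by rewrite lt_min ltr01 !divr_gt0.
have e'e : M * (`|u| + `|f x| + `|g x|) * e' <= e / 3.
  rewrite (@le_trans _ _ (C * e'))//.
    by rewrite ler_wpM2r ?ltW//; rewrite /C ltrDl.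
  by rewrite mulrC -ler_pdivlMr// ge_min lexx orbT.
have [d1 d10 hf] := (is_derivP _ _ _ _).1 fu _ e'0.
have [d2 d20 hg] := (is_derivP _ _ _ _).1 gv _ e'0.
pose C2 := M * (`|u| + 1) + 1.
have C20 : 0 < C2 by rewrite ltr_wpDl// mulr_ge0// addr_ge0.
have [d3 d30 hc] := is_deriv_cont gv (divr_gt0 (divr_gt0 e0 (ltr0Sn _ 2)) C20).
have [d4 d40 lip] := is_deriv_lip fu.
exists (Num.min (Num.min d1 d2) (Num.min d3 d4)).
  by rewrite !lt_min d10 d20 d30.
move=> y Wy; rewrite !lt_min => /andP[/andP[y1 y2] /andP[y3 y4]].
rewrite blinDE bbilLE bbilRE.
(* The product of increments is negligible because [f] is Lipschitz at [x] while the increment of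
   [g] tends to 0. *)
rewrite (_ : _ - _ = B (f y - f x) (g y - g x) + B (f y - f x - u (y - x)) (g x)
   + B (f x) (g y - g x - v (y - x))); last first.
  rewrite !bbilBl !bbilBr; set a := B (f y) _; set b := B _ _.
  set c := B _ _; set d := B _ _; set k := B _ _; set l := B _ _.
  zmod.
have e3 : e = e / 3 + e / 3 + e / 3 by lra.
have n0 : 0 <= `|y - x| by [].
rewrite [e in leRHS]e3 !mulrDl.
rewrite (le_trans (ler_normD _ _))// lerD//; last first.
  rewrite (le_trans (BM _ _))//.
  rewrite (@le_trans _ _ (M * `|f x| * (e' * `|y - x|)))//.
    by rewrite ler_wpM2l ?mulr_ge0// hg.
  rewrite mulrA ler_wpM2r// (le_trans _ e'e)// ler_wpM2r ?(ltW e'0)// ler_wpM2l//.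
  by rewrite -addrA addrCA lerDl addr_ge0.
rewrite (le_trans (ler_normD _ _))// lerD//; last first.
  rewrite (le_trans (BM _ _))//.
  rewrite (@le_trans _ _ (M * (e' * `|y - x|) * `|g x|))//.
    by rewrite ler_wpM2r// ler_wpM2l// hf.
  rewrite mulrAC mulrA ler_wpM2r// (le_trans _ e'e)// ler_wpM2r ?(ltW e'0)// ler_wpM2l//.
  by rewrite lerDr addr_ge0.
rewrite (le_trans (BM _ _))//.
rewrite (@le_trans _ _ (M * ((`|u| + 1) * `|y - x|) * (e / 3 / C2)))//.
  rewrite ler_pM ?mulr_ge0// ?ler_wpM2l ?lip//; exact/ltW/hc.
rewrite (_ : _ * _ = M * (`|u| + 1) * (e / 3) / C2 * `|y - x|); last by ring.
rewrite ler_wpM2r// ler_pdivrMr// mulrC ler_wpM2l//.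
  by rewrite divr_ge0// ltW.
by rewrite /C2 lerDl.
Qed.

End Calculus.

(** * Maps of class C^n *)

Section SmoothMaps.
Context {R : realType}.
Implicit Types E F G H : normedModType R.

Lemma Cn_on_ext n E F (W : set E) (h k : E -> F) :
  (forall y, W y -> h y = k y) -> Cn_on n W h -> Cn_on n W k.
Proof.
move=> hk; case: n => [/within_contP hc|n [h' [hh' h'n]]] /=.
  apply/within_contP => x Wx e /(hc x Wx)[d d0 hd]; exists d => // y Wy yx.
  by rewrite -!hk//; exact: hd.
exists h'; split=> // x Wx; apply: is_deriv_ext (hh' x Wx) => //.
Qed.

Lemma Cn_on_sub n E F (W V : set E) (h : E -> F) :
  V `<=` W -> Cn_on n W h -> Cn_on n V h.
Proof.
move=> VW; elim: n F h => [|n IH] F h.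
  move=> /within_contP hc; apply/within_contP => x /VW Wx e /(hc x Wx)[d d0 hd].
  by exists d => // y /VW Wy; exact: hd.
move=> [h' [hh' h'n]]; exists h'; split; last exact: IH.
by move=> x /VW/hh'; exact: is_deriv_sub.
Qed.

Lemma Cn_onS n E F (W : set E) (h : E -> F) : Cn_on n.+1 W h -> Cn_on n W h.
Proof.
elim: n F h => [|n IH] F h [h' [hh' h'n]].
  by apply/within_contP => x Wx e e0; exact: is_deriv_cont (hh' x Wx) _ e0.
by exists h'; split=> //; exact: IH.
Qed.

Lemma Cn_on_cont n E F (W : set E) (h : E -> F) :
  Cn_on n W h -> {within W, continuous h}.
Proof. by elim: n => // n IH /Cn_onS. Qed.

Lemma Cn_on_cst n E F (W : set E) (b : F) : Cn_on n W (cst b).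
Proof.
elim: n F b => [|n IH] F b.
  by apply/within_contP => x _ e e0; exists 1 => // y _ _; rewrite subrr normr0.
exists (cst 0); split; last exact: IH.
by move=> x _; exact: is_deriv_cst.
Qed.

Lemma Cn_on_blin n E F (W : set E) (u : blin E F) : Cn_on n W u.
Proof.
apply: Cn_onS; exists (cst u); split; last exact: Cn_on_cst.
by move=> x _; exact: is_deriv_blin.
Qed.

Lemma Cn_onD n E F (W : set E) (h k : E -> F) :
  Cn_on n W h -> Cn_on n W k -> Cn_on n W (fun x => h x + k x).
Proof.
elim: n F h k => [|n IH] F h k.
  move=> /within_contP hc /within_contP kc; apply/within_contP => x Wx e e0.
  have e2 : 0 < e / 2 by rewrite divr_gt0.
  have [d d0 hd] := hc x Wx _ e2; have [d' d'0 kd] := kc x Wx _ e2.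
  exists (Num.min d d'); first by rewrite lt_min d0.
  move=> y Wy; rewrite lt_min => /andP[yd yd'].
  rewrite opprD addrACA (le_lt_trans (ler_normD _ _))// [e]splitr.
  by rewrite ltrD ?hd ?kd.
move=> [h' [hh' h'n]] [k' [kk' k'n]].
exists (fun x => h' x + k' x); split; last exact: IH.
by move=> x Wx; apply: is_derivD; [exact: hh'|exact: kk'].
Qed.

Lemma Cn_on_bbil n E F1 F2 G (B : bbil F1 F2 G) (W : set E) (f : E -> F1)
    (g : E -> F2) :
  Cn_on n W f -> Cn_on n W g -> Cn_on n W (fun x => B (f x) (g x)).
Proof.
elim: n F1 F2 G B f g => [|n IH] F1 F2 G B f g.
  move=> /within_contP fc /within_contP gc; apply/within_contP => x Wx e e0.
  have [M M0 BM] := bbil_bound B.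
  pose C := M * (`|g x| + 1 + `|f x|) + 1.
  have C0 : 0 < C by rewrite ltr_wpDl// mulr_ge0// !addr_ge0.
  have eC : 0 < e / C by rewrite divr_gt0.
  have [d1 d10 fd] := fc x Wx _ eC; have [d2 d20 gd] := gc x Wx _ eC.
  have [d3 d30 gd1] := gc x Wx _ ltr01.
  exists (Num.min (Num.min d1 d2) d3); first by rewrite !lt_min d10 d20.
  move=> y Wy; rewrite !lt_min => /andP[/andP[y1 y2] y3].
  rewrite (_ : _ - _ = B (f y - f x) (g y) + B (f x) (g y - g x)); last first.
    by rewrite bbilBl bbilBr; zmod.
  have gy : `|g y| <= `|g x| + 1.
    rewrite -(subrK (g x) (g y)) addrC (le_trans (ler_normD _ _))// lerD2l.
    exact/ltW/gd1.
  rewrite (le_lt_trans (ler_normD _ _))//.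
  rewrite (@le_lt_trans _ _ (M * (`|g x| + 1 + `|f x|) * (e / C)))//; last first.
    by rewrite mulrCA gtr_pMr// ltr_pdivrMr// mul1r /C ltrDl.
  rewrite mulrDr mulrDl lerD// (le_trans (BM _ _))//.
    by rewrite mulrAC ler_pM ?mulr_ge0// ?ler_wpM2l//; exact/ltW/fd.
  by rewrite ler_wpM2l ?mulr_ge0//; exact/ltW/gd.
move=> fn gn; have [f' [ff' f'n]] := fn; have [g' [gg' g'n]] := gn.
exists (fun x => bbilL E B (f' x) (g x) + bbilR E B (f x) (g' x)); split.
  by move=> x Wx; apply: is_deriv_bbil; [exact: ff'|exact: gg'].
by apply: Cn_onD; apply: IH => //; exact: Cn_onS.
Qed.

(** The induction ranges over [G] because [g'] takes operator values. The derivative is the bilinear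
    composite of [g' \o f], smooth by induction with [f] taken one order lower, and of [f']. *)
Lemma Cn_on_comp n E F G (W : set E) (V : set F) (f : E -> F) (g : F -> G) :
  (forall x, W x -> V (f x)) -> Cn_on n W f -> Cn_on n V g ->
  Cn_on n W (g \o f).
Proof.
move=> WV; elim: n G g => [|n IH] G g.
  move=> /within_contP fc /within_contP gc; apply/within_contP => x Wx e e0.
  have [d d0 gd] := gc _ (WV _ Wx) _ e0; have [d' d'0 fd] := fc x Wx _ d0.
  by exists d' => // y Wy yx; apply: gd; [exact: WV|exact: fd].
move=> fn [g' [gg' g'n]]; have [f' [ff' f'n]] := fn.
exists (fun x => bbil_comp E F G (g' (f x)) (f' x)); split.
  move=> x Wx; rewrite bbil_compE.
  by apply: is_deriv_comp (ff' x Wx) (gg' _ (WV _ Wx)).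
by apply: Cn_on_bbil => //; apply: IH g'n; exact: Cn_onS.
Qed.

Lemma is_derivZ E F (W : set E) (h : E -> F) x u a :
  is_deriv W h x u -> is_deriv W (fun y => a *: h y) x (a *: u).
Proof.
move=> hu; have [->|a0] := eqVneq a 0.
  rewrite scale0r (_ : (fun _ => _) = cst 0); first exact: is_deriv_cst.
  by apply/funext => y; rewrite scale0r.
apply/is_derivP => e e0.
have /((is_derivP _ _ _ _).1 hu)[d d0 hd] : 0 < e / `|a|.
  by rewrite divr_gt0// normr_gt0.
exists d => // y Wy yx; rewrite blinZE -!scalerBr normrZ -ler_pdivlMl ?normr_gt0//.
by rewrite (le_trans (hd y Wy yx))// mulrA [leRHS]mulrAC mulrAC [_^-1 * e]mulrC.
Qed.

Lemma Cn_onZ n E F (W : set E) (h : E -> F) a :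
  Cn_on n W h -> Cn_on n W (fun x => a *: h x).
Proof.
elim: n F h => [|n IH] F h.
  move=> /within_contP hc; apply/within_contP => x Wx e e0.
  have a0 : 0 < `|a| + 1 by rewrite ltr_wpDl.
  have [d d0 hd] := hc x Wx _ (divr_gt0 e0 a0); exists d => // y Wy yx.
  rewrite -scalerBr normrZ (@le_lt_trans _ _ ((`|a| + 1) * `|h y - h x|))//.
    by rewrite ler_wpM2r// lerDl.
  by rewrite mulrC -ltr_pdivlMr// hd.
move=> [h' [hh' h'n]]; exists (fun x => a *: h' x); split; last exact: IH.
by move=> x Wx; apply: is_derivZ; exact: hh'.
Qed.

Section Inversion.
Variables (E F G : normedModType R) (W : set E).
Variables (h : E -> blin F G) (J : E -> blin G F) (M : R).
Hypothesis hJ : forall x, W x -> forall z, h x (J x z) = z.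
Hypothesis Jh : forall x, W x -> forall z, J x (h x z) = z.
Hypothesis JM : forall x, W x -> `|J x| <= M.

Let M_ge0 x : W x -> 0 <= M.
Proof. by move=> /JM; exact: le_trans. Qed.

(** This is the resolvent identity: [J y - J x] is the composite of [J y], [h x - h y] and [J x]. *)
Let J_lip x y : W x -> W y -> `|J y - J x| <= M * M * `|h y - h x|.
Proof.
move=> Wx Wy; have M0 := M_ge0 Wx.
apply: blin_norm_le => [|z]; first by rewrite !mulr_ge0.
rewrite blinBE (_ : _ - _ = J y (h x (J x z) - h y (J x z))); last first.
  by rewrite linearB/= (Jh Wy) hJ.
rewrite -blinBE distrC.
rewrite (_ : _ * _ * _ * _ = M * (`|h x - h y| * (M * `|z|))); last by ring.
by rewrite !ler_blin_le// JM.
Qed.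

Lemma is_deriv_inv x h' : W x -> is_deriv W h x h' ->
  is_deriv W J x (- bbilR E (bbil_comp G G F) (J x)
     (bbilL E (bbil_comp G F G) h' (J x))).
Proof.
move=> Wx hh'; have M0 := M_ge0 Wx; apply/is_derivP => e e0.
pose C := M * M * (1 + M * (`|h'| + 1)) + 1.
have C0 : 0 < C.
  by rewrite ltr_wpDl// !mulr_ge0// addr_ge0// mulr_ge0// addr_ge0.
have eC : 0 < e / C by rewrite divr_gt0.
have [d1 d10 hd1] := (is_derivP _ _ _ _).1 hh' _ eC.
have [d2 d20 hd2] := is_deriv_lip hh'.
have [d3 d30 hd3] := is_deriv_cont hh' eC.
exists (Num.min (Num.min d1 d2) d3); first by rewrite !lt_min d10 d20.
move=> y Wy; rewrite !lt_min => /andP[/andP[y1 y2] y3].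
set n := `|y - x|; have n0 : 0 <= n by exact: normr_ge0.
apply: blin_norm_le => [|z]; first by rewrite mulr_ge0// ltW.
rewrite !blinBE (blinNE (bbilR _ _ _ _)) (blinNE (bbilR _ _ _ _ _)).
rewrite bbilRE bbilLE !bbil_compE /=.
(* The first term carries the remainder of [h]. The second is of second order, since [J_lip] bounds
   [J y - J x] by the increment of [h]. The constant [C] collects the factors of both. *)
rewrite (_ : _ - _ - _ = - J x ((h y - h x - h' (y - x)) (J x z)) -
   (J y - J x) ((h y - h x) (J x z))); last first.
  rewrite !blinBE !(linearB (J x))/= !(linearB (J y))/= hJ// (Jh Wy).
  by zmod.
rewrite (@le_trans _ _ (C * (e / C * n) * `|z|))//; last first.
  by rewrite mulrA mulrCA divff ?gt_eqF// mulr1.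
rewrite (@le_trans _ _ (M * M * (1 + M * (`|h'| + 1)) * (e / C * n) * `|z|))//;
  last first.
  rewrite ler_wpM2r// ler_wpM2r//; last by rewrite /C lerDl.
  by rewrite mulr_ge0// ltW.
rewrite (_ : _ * _ * _ * _ = M * (e / C * n * (M * `|z|)) +
    M * M * (e / C) * (((`|h'| + 1) * n) * (M * `|z|))); last by ring.
rewrite (le_trans (ler_normB _ _))// lerD//.
  by rewrite normrN !ler_blin_le ?JM// hd1.
rewrite ler_blin_le//; last by rewrite !ler_blin_le ?hd2// JM.
by rewrite (le_trans (J_lip Wx Wy))// ler_wpM2l ?mulr_ge0//; exact/ltW/hd3.
Qed.

(** Bootstrap: the derivative of [J] is a bilinear expression in [J] and [h'], so it inherits the
    order already known for [J]. *)
Lemma Cn_on_inv n : Cn_on n W h -> Cn_on n W J.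
Proof.
elim: n => [|n IH].
  move=> /within_contP hc; apply/within_contP => x Wx e e0.
  have M0 := M_ge0 Wx.
  have C0 : 0 < M * M + 1 by rewrite ltr_wpDl// mulr_ge0.
  have [d d0 hd] := hc x Wx _ (divr_gt0 e0 C0); exists d => // y Wy yx.
  rewrite (le_lt_trans (J_lip Wx Wy))//.
  rewrite (@le_lt_trans _ _ (M * M * (e / (M * M + 1))))//.
    by rewrite ler_wpM2l ?mulr_ge0//; exact/ltW/hd.
  by rewrite mulrCA gtr_pMr// ltr_pdivrMr// mul1r ltrDl.
move=> hn; have Jn := IH (Cn_onS hn); case: hn => h' [hh' h'n].
exists (fun x => - 1 *: bbilR E (bbil_comp G G F) (J x)
     (bbilL E (bbil_comp G F G) (h' x) (J x))).
split=> [x Wx|]; first by rewrite scaleN1r; exact: is_deriv_inv (hh' x Wx).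
apply: Cn_onZ; apply: Cn_on_bbil => //; exact: Cn_on_bbil.
Qed.
End Inversion.

End SmoothMaps.

(** * Inverse functions on half spaces *)

Section HalfSpaces.
Context {R : realType} {E : normedModType R}.
Implicit Types (l : E -> R) (W : set E).

Lemma functionalD l x y : functional l -> l (x + y) = l x + l y.
Proof. by move=> [ll _]; have := ll 1 x y; rewrite scale1r mul1r. Qed.

Lemma functional0 l : functional l -> l 0 = 0.
Proof.
by move=> lf; have := lf.1 (-1) 0 0; rewrite scaler0 addr0 mulN1r addNr.
Qed.

Lemma functionalZ l a x : functional l -> l (a *: x) = a * l x.
Proof.
by move=> lf; have := lf.1 a x 0; rewrite addr0 (functional0 lf) addr0.
Qed.

Lemma functionalN l x : functional l -> l (- x) = - l x.
Proof. by move=> lf; rewrite -scaleN1r functionalZ// mulN1r. Qed.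

Lemma functionalB l x y : functional l -> l (x - y) = l x - l y.
Proof. by move=> lf; rewrite functionalD// functionalN. Qed.

Lemma functional_bound l :
  functional l -> exists2 M, 0 <= M & forall x, `|l x| <= M * `|x|.
Proof.
move=> [ll lc].
have lb : (l : E -> R^o) \in @blin_pred R E R^o by apply/asboolP; split.
by exists `|Blin lb| => // x; exact: (ler_blin (Blin lb)).
Qed.

(** By its bound [M], the functional stays nonnegative on the ball of radius [l x / (M + 1)], and
    there the half space imposes no condition. *)
Lemma rel_open_interior l W x : half_form l -> rel_open (halfspace l) W ->
  W x -> 0 < l x ->
  exists2 d, 0 < d & forall y, `|y - x| < d -> W y.
Proof.
move=> hl /rel_openP[_ hW] Wx lx; have [d d0 hd] := hW x Wx.
case: hl => [[lf _]|l1]; last first.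
  by exists d => // y; apply: hd; rewrite /halfspace/= l1.
have [M M0 lM] := functional_bound lf.
have M1 : 0 < M + 1 by rewrite ltr_wpDl.
exists (Num.min d (l x / (M + 1))); first by rewrite lt_min d0 divr_gt0.
move=> y; rewrite lt_min => /andP[yd yx]; apply: hd => //.
rewrite /halfspace/= -(subrK x y) functionalD//.
have : `|l (y - x)| <= l x.
  rewrite (le_trans (lM _))// (@le_trans _ _ ((M + 1) * `|y - x|))//.
    by rewrite ler_wpM2r// lerDl.
  by rewrite mulrC -ler_pdivlMr// ltW.
by rewrite ler_norml => /andP[+ _]; rewrite -subr_ge0 opprK addrC.
Qed.

(** Vectors with [0 <= l z] point into the half space from each of its points, boundary included;
    one-sided derivatives are tested along them. *)
Lemma rel_open_dir l W x z : half_form l -> rel_open (halfspace l) W ->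
  W x -> 0 <= l z ->
  exists2 d, 0 < d & forall t, 0 < t -> t < d -> W (x + t *: z).
Proof.
move=> hl /rel_openP[WH hW] Wx lz; have [d d0 hd] := hW x Wx.
have z1 : 0 < `|z| + 1 by rewrite ltr_wpDl.
exists (d / (`|z| + 1)); first by rewrite divr_gt0.
move=> t t0 td; apply: hd.
  case: hl => [[lf _]|l1]; last by rewrite /halfspace/= l1.
  rewrite /halfspace/= functionalD// functionalZ// addr_ge0 ?(WH _ Wx)//.
  by rewrite mulr_ge0// ltW.
rewrite [x + _]addrC addrK normrZ gtr0_norm//.
rewrite (@le_lt_trans _ _ (t * (`|z| + 1)))//; last by rewrite -ltr_pdivlMr.
by rewrite ler_wpM2l ?lerDl// ltW.
Qed.

Lemma is_deriv_dir (F : normedModType R) W (h : E -> F) x (u : blin E F) z :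
  is_deriv W h x u ->
  (exists2 d, 0 < d & forall t, 0 < t -> t < d -> W (x + t *: z)) ->
  forall e, 0 < e -> exists t, [/\ 0 < t, W (x + t *: z) &
    `|h (x + t *: z) - h x - t *: u z| <= e * t].
Proof.
move=> /is_derivP hu [d d0 hd] e e0.
have z1 : 0 < `|z| + 1 by rewrite ltr_wpDl.
have [d' d'0 hd'] := hu _ (divr_gt0 e0 z1).
pose t := Num.min d (d' / (`|z| + 1)) / 2.
have m0 : 0 < Num.min d (d' / (`|z| + 1)) by rewrite lt_min d0 divr_gt0.
have t0 : 0 < t by rewrite divr_gt0.
have : t < Num.min d (d' / (`|z| + 1)) by rewrite ltr_pdivrMr// ltr_pMr// ltrDl.
rewrite lt_min => /andP[td td'].
exists t; split=> //; first exact: hd.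
have tz : `|t *: z| = t * `|z| by rewrite normrZ gtr0_norm.
have := hd' _ (hd _ t0 td); rewrite [x + _]addrC addrK linearZ/= tz => hz.
rewrite addrC -addrC (le_trans (hz _))//.
  rewrite (@le_lt_trans _ _ (t * (`|z| + 1)))//; last by rewrite -ltr_pdivlMr.
  by rewrite ler_wpM2l ?lerDl// ltW.
rewrite mulrCA mulrC ler_wpM2r ?(ltW t0)//.
by rewrite mulrAC ler_pdivrMr// ler_wpM2l ?lerDl// ltW.
Qed.

(** Only directions pointing into the half space can be tested, but every vector or its opposite is
    one of them, and linearity does the rest. *)
Lemma is_deriv_unique (F : normedModType R) l W (h : E -> F) x u v :
  half_form l -> rel_open (halfspace l) W -> W x ->
  is_deriv W h x u -> is_deriv W h x v -> u = v.
Proof.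
move=> hl oW Wx hu hv.
have key z : 0 <= l z -> u z = v z.
  move=> lz; apply/eqP; rewrite -subr_eq0 -normr_le0.
  apply/ler_addgt0Pr => e e0; rewrite add0r.
  have huv : is_deriv W (fun y => h y + (-1) *: h y) x (u + (-1) *: v).
    by apply: is_derivD => //; exact: is_derivZ.
  have [t [t0 Wt ht]] := is_deriv_dir huv (rel_open_dir hl oW Wx lz) e0.
  move: ht; rewrite !scaleN1r !subrr add0r normrN normrZ gtr0_norm//.
  by rewrite [e * t]mulrC ler_pM2l.
apply: blinP => z; have [lz|lz] := leP 0 (l z); first exact: key.
apply: oppr_inj; rewrite -!linearN; apply: key.
case: hl lz => [[lf _]|->]; last by rewrite ltr10.
by rewrite functionalN// oppr_ge0 => /ltW.
Qed.

Lemma ler_dist_max0 (a b : R) : `|Num.max 0 a - Num.max 0 b| <= `|a - b|.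
Proof.
have := ler_norm (b - a); rewrite distrC; have := ler_norm (a - b).
move: `|a - b| => n h1 h2; rewrite ler_norml; apply/andP.
by case: (leP 0 a) => a0; case: (leP 0 b) => b0; split; lra.
Qed.

(** Points off the half space are pushed along a fixed [e] with [l e = 1] until they reach the
    kernel of [l]. The retraction is not smooth, but the contraction argument that uses it asks only
    for a Lipschitz constant. *)
Lemma half_form_retraction l : half_form l -> exists (pi : E -> E) L,
  [/\ 1 <= L, forall x, 0 <= l (pi x), forall x, 0 <= l x -> pi x = x,
      forall x y, `|pi x - pi y| <= L * `|x - y| &
      forall x, l x < 0 -> l (pi x) = 0].
Proof.
case=> [[lf [v lv]]|->]; last first.
  by exists id, 1; split=> // [x y|x]; rewrite ?mul1r// /cst ltr10.
have [M M0 lM] := functional_bound lf.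
pose e := (l v)^-1 *: v; have le : l e = 1 by rewrite functionalZ// mulVf.
exists (fun x => x + Num.max 0 (- l x) *: e), (1 + M * `|e|); split.
- by rewrite lerDl mulr_ge0.
- move=> x; rewrite functionalD// functionalZ// le mulr1.
  by rewrite -(subrr (l x)) lerD2l le_max lexx orbT.
- by move=> x lx; rewrite max_l ?oppr_le0// scale0r addr0.
- move=> x y; rewrite opprD addrACA -scalerBl.
  rewrite (le_trans (ler_normD _ _))// mulrDl mul1r lerD2l normrZ mulrAC.
  rewrite ler_wpM2r// (le_trans _ (lM _))// functionalB//.
  rewrite (le_trans (ler_dist_max0 _ _))//.
  by rewrite -opprD normrN.
- move=> x lx; rewrite max_r ?oppr_ge0 ?ltW//.
  by rewrite functionalD// functionalZ// le mulr1 subrr.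
Qed.

End HalfSpaces.

Section MeanValue.
Context {R : realType} {E F : normedModType R}.

(** Local derivative bounds are propagated along the segment: the slack [e] absorbs the remainders,
    and the supremum of the times up to which the bound of slope [M + e] holds is attained and
    cannot lie below 1. *)
Lemma mean_value_inequality (W : set E) (h : E -> F) (h' : E -> blin E F)
    x y M :
  (forall t, 0 <= t <= 1 -> W (x + t *: (y - x))) ->
  (forall z, W z -> is_deriv W h z (h' z)) ->
  (forall z, W z -> `|h' z| <= M) ->
  `|h y - h x| <= M * `|y - x|.
Proof.
move=> Wxy hh' h'M.
have M0 : 0 <= M.
  by apply: le_trans (h'M _ (Wxy 0 _)) => //; rewrite lexx ler01.
suff key e : 0 < e -> `|h y - h x| <= (M + e) * `|y - x|.
  apply/ler_addgt0Pr => e e0; have n1 : 0 < `|y - x| + 1 by rewrite ltr_wpDl.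
  rewrite (le_trans (key (e / (`|y - x| + 1)) _))// ?divr_gt0//.
  rewrite mulrDl lerD2l mulrAC ler_pdivrMr// ler_wpM2l ?ltW//.
  by rewrite ltrDl.
move=> e0; set n := `|y - x|; have n0 : 0 <= n by exact: normr_ge0.
pose K := (M + e) * n; have K0 : 0 <= K by rewrite mulr_ge0// addr_ge0// ltW.
pose c t := x + t *: (y - x).
have cB s t : c s - c t = (s - t) *: (y - x).
  rewrite scalerBl /c. by zmod.
have loc t : 0 <= t <= 1 -> exists2 d, 0 < d & forall s, 0 <= s <= 1 ->
    `|s - t| < d -> `|h (c s) - h (c t)| <= K * `|s - t|.
  move=> t01; have [d d0 hd] := (is_derivP _ _ _ _).1 (hh' _ (Wxy _ t01)) _ e0.
  have n1 : 0 < n + 1 by rewrite ltr_wpDl.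
  exists (d / (n + 1)); first by rewrite divr_gt0.
  move=> s s01 st; have nst : `|c s - c t| = `|s - t| * n by rewrite cB normrZ.
  have sd : `|c s - c t| < d.
    rewrite nst (@le_lt_trans _ _ (`|s - t| * (n + 1)))//.
      by rewrite ler_wpM2l// lerDl.
    by rewrite -ltr_pdivlMr.
  rewrite -(subrK (h' (c t) (c s - c t)) (h (c s) - h (c t))).
  rewrite (_ : K * `|s - t| = e * `|c s - c t| + M * `|c s - c t|); last first.
    by rewrite nst /K; ring.
  rewrite (le_trans (ler_normD _ _))// lerD//.
    by apply: hd => //; exact: Wxy.
  by rewrite ler_blin_le// h'M//; exact: Wxy.
pose S := [set t | 0 <= t <= 1 /\ `|h (c t) - h (c 0)| <= K * t].
have S0 : S 0 by split; rewrite ?lexx ?ler01// subrr normr0 mulr0.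
have Sub : has_ubound S by exists 1 => t [/andP[]].
have hS : has_sup S by split=> //; exists 0.
pose b := sup S.
have b0 : 0 <= b by exact: (ub_le_sup Sub).
have b1 : b <= 1 by apply: ge_sup; [exists 0|move=> t [/andP[]]].
have b01 : 0 <= b <= 1 by rewrite b0.
have [d d0 hd] := loc b b01.
have Sb : `|h (c b) - h (c 0)| <= K * b.
  have [t [t01 St] bt] := sup_adherent d0 hS.
  have tb : t <= b by exact: (ub_le_sup Sub).
  have btd : `|t - b| < d.
    by rewrite distrC ger0_norm ?subr_ge0//; rewrite -/b in bt; lra.
  have := hd t t01 btd.
  rewrite distrC [`|t - b|]distrC ger0_norm ?subr_ge0// => h1.
  rewrite -(subrK (h (c t)) (h (c b))) -addrA (le_trans (ler_normD _ _))//.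
  by rewrite (le_trans (lerD h1 St))// -mulrDr subrK.
have bE : b = 1.
  apply/eqP; rewrite eq_le b1 leNgt; apply/negP => blt.
  (* A step shorter than the radius [d] available at [b], and not leading past 1. *)
  pose s := b + Num.min (d / 2) (1 - b).
  have m0 : 0 < Num.min (d / 2) (1 - b) by rewrite lt_min subr_gt0 blt divr_gt0.
  have md : Num.min (d / 2) (1 - b) < d.
    by rewrite gt_min ltr_pdivrMr// ltr_pMr// ltrDl ltr01.
  have s1 : s <= 1 by rewrite /s -lerBrDl ge_min lexx orbT.
  have s01 : 0 <= s <= 1 by rewrite s1 andbT addr_ge0// ltW.
  have sbE : `|s - b| = s - b.
    by rewrite ger0_norm// subr_ge0 lerDl ltW.
  have sbd : `|s - b| < d by rewrite sbE /s addrC addKr.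
  have := hd s s01 sbd; rewrite sbE => h1.
  have : S s.
    split=> //; rewrite -(subrK (h (c b)) (h (c s))) -addrA.
    rewrite (le_trans (ler_normD _ _))// (le_trans (lerD h1 Sb))//.
    by rewrite -mulrDr subrK.
  by move=> /(ub_le_sup Sub); rewrite -/b leNgt ltrDl m0.
have c1 : c 1 = y by rewrite /c scale1r addrC subrK.
have c0 : c 0 = x by rewrite /c scale0r addr0.
by move: Sb; rewrite bE c1 c0 mulr1.
Qed.

End MeanValue.

Section NearIdentity.
Context {R : realType} {E : completeNormedModType R}.

(** The solution is a fixed point of [x |-> y - g x], a contraction of factor 1/2. The closed ball
    is preserved: one half of [r] comes from the position of [y], the other from the variation of
    [g]. *)
Lemma lipschitz_perturbation_solve (g : E -> E) x0 r y :
  0 <= r ->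
  (forall x x', `|x - x0| <= r -> `|x' - x0| <= r ->
     `|g x - g x'| <= 2^-1 * `|x - x'|) ->
  `|y - (x0 + g x0)| <= 2^-1 * r ->
  exists2 x, `|x - x0| <= r & x + g x = y.
Proof.
move=> r0 glip yr; pose U := [set x : E | `|x - x0| <= r].
have Ux0 : U x0 by rewrite /U/= subrr normr0.
pose f x := y - g x.
have fU : {homo f : x / U x >-> U x}.
  move=> x Ux; rewrite /U/= /f.
  rewrite (_ : _ - _ = (y - (x0 + g x0)) - (g x - g x0)); last by zmod.
  rewrite (le_trans (ler_normB _ _))// (le_trans (lerD yr (glip _ _ Ux Ux0)))//.
  by rewrite -mulrDr -[leRHS]mul1r; have := Ux; rewrite /U/=; lra.
pose F : {fun U >-> U} := mkfun_fun fU.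
have [|||x Ux xf] := @banach_fixed_point R E U F.
- exists (2^-1)%:nng; split=> [|[x x'] [/= Ux Ux']]; first by rewrite /=; lra.
  change (`|f x - f x'| <= 2^-1 * `|x - x'|).
  by rewrite (_ : _ - _ = - (g x - g x')) ?normrN ?glip// /f; zmod.
- rewrite (_ : U = (fun x => `|x - x0|) @^-1` [set s | s <= r])//.
  apply: closed_comp; last exact: closed_le.
  by move=> x _; apply: cvg_norm; apply: cvgB => //; exact: cvg_cst.
- by exists x0.
- have xE : x = y - g x := xf.
  by exists x => //; rewrite [X in X + _]xE subrK.
Qed.

(** [A] perturbs the identity by a 1/2-Lipschitz map, which gives surjectivity; the estimate
    [|z| <= 2 * |A z|] gives injectivity and the bound 2. *)
Lemma near_id_inverse (A : blin E E) : `|A - blin_id E| <= 2^-1 ->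
  exists J : blin E E, [/\ forall z, A (J z) = z, forall z, J (A z) = z &
    `|J| <= 2].
Proof.
move=> A1.
have Az z : `|A z - z| <= 2^-1 * `|z|.
  by rewrite (_ : _ - _ = (A - blin_id E) z)// ler_blin_le.
have low z : `|z| <= 2 * `|A z|.
  have : `|z| <= `|A z| + `|A z - z|.
    by rewrite -[X in `|X| <= _](subKr (A z)) (le_trans (ler_normB _ _)).
  by have := Az z; lra.
have surj y : exists x, A x = y.
  (* Starting from 0, the radius [2 * |y|] is the smallest one for which [y] is within half the
     radius. *)
  have [| | |x _ xy] := @lipschitz_perturbation_solve (fun x => A x - x) 0
      (2 * `|y|) y.
  - by rewrite mulr_ge0.
  - move=> x x' _ _; rewrite (_ : _ - _ = A (x - x') - (x - x')) ?Az//.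
    by rewrite (linearB A)/=; zmod.
  - by rewrite linear0 subrr addr0 subr0 mulrA mulVf ?mul1r.
  - by exists x; rewrite -xy addrC subrK.
have inj x x' : A x = A x' -> x = x'.
  move=> xx'; apply/eqP; rewrite -subr_eq0 -normr_le0.
  by rewrite (le_trans (low _))// (linearB A)/= xx' subrr normr0 mulr0.
have [J AJ] := choice surj.
have JA z : J (A z) = z by apply: inj; rewrite AJ.
have Jb : J \in @blin_pred R E E.
  apply: blin_predP => [a x y|]; first by apply: inj; rewrite (linearP A)/= !AJ.
  by exists 2 => x; rewrite (le_trans (low _))// AJ.
exists (Blin Jb); split=> //; apply: blin_norm_le => // z /=.
by rewrite (le_trans (low _))// AJ.
Qed.

End NearIdentity.

Section InverseSmooth.
Context {R : realType} {E : completeNormedModType R}.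
Variables (l : E -> R) (W : set E) (Phi : E -> E) (Phi' : E -> blin E E).
Hypotheses (hl : half_form l) (oW : rel_open (halfspace l) W).

(** Being within 1/2 of the identity, the derivatives have inverses [J] bounded by 2 uniformly, as
    [Cn_on_inv] demands. The derivative of [Psi] is [J \o Psi], so each order known for [Psi] yields
    the next. *)
Lemma Cn_on_inverse (Psi : E -> E) (K : R) :
  (forall x, W x -> Psi (Phi x) = x) ->
  (forall x x', W x -> W x' -> `|x - x'| <= K * `|Phi x - Phi x'|) ->
  (forall x, W x -> is_deriv W Phi x (Phi' x)) ->
  (forall x, W x -> `|Phi' x - blin_id E| <= 2^-1) ->
  forall n, Cn_on n W Phi -> Cn_on n (Phi @` W) Psi.
Proof.
move=> PsiK lip Phi'E near_id.
have K1 : 0 < `|K| + 1 by rewrite ltr_wpDl.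
have {}lip x x' : W x -> W x' -> `|x - x'| <= (`|K| + 1) * `|Phi x - Phi x'|.
  move=> Wx Wx'; rewrite (le_trans (lip _ _ Wx Wx'))// ler_wpM2r//.
  by rewrite (le_trans (ler_norm K))// lerDl.
have /choice[J hJ] : forall x, exists J : blin E E, W x -> [/\
    forall z, Phi' x (J z) = z, forall z, J (Phi' x z) = z & `|J| <= 2].
  move=> x; have [Wx|nWx] := pselect (W x); last by exists 0.
  by have [J] := near_id_inverse (near_id x Wx); exists J.
elim=> [|n IH].
  move=> _; apply/within_contP => _ [x Wx <-] e e0.
  exists (e / (`|K| + 1)); first by rewrite divr_gt0.
  move=> _ [x' Wx' <-] xx'; rewrite !PsiK// (le_lt_trans (lip _ _ Wx' Wx))//.
  by rewrite mulrC -ltr_pdivlMr.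
move=> Phin; have Psin := IH (Cn_onS Phin).
have [Phi2 [Phi2E Phi2n]] := Phin.
(* The derivative inside [Cn_on] is an existential witness; uniqueness on a relatively open subset
   of the half space identifies it with [Phi']. *)
have Phi2_eq x : W x -> Phi2 x = Phi' x.
  by move=> Wx; apply: is_deriv_unique hl oW Wx (Phi2E x Wx) (Phi'E x Wx).
exists (J \o Psi); split; last first.
  apply: (@Cn_on_comp _ _ _ _ _ _ W) => //; first by move=> _ [x Wx <-]; rewrite PsiK.
  apply: (@Cn_on_inv _ _ _ _ _ Phi' _ 2).
  - by move=> x Wx; have [] := hJ x Wx.
  - by move=> x Wx; have [] := hJ x Wx.
  - by move=> x Wx; have [] := hJ x Wx.
  - by apply: Cn_on_ext Phi2n.
move=> _ [x Wx <-] /=; rewrite PsiK//; have [PJ JP J2] := hJ x Wx.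
apply/is_derivP => e e0.
have C0 : 0 < 2 * (`|K| + 1) by rewrite mulr_gt0.
have [d d0 hd] := (is_derivP _ _ _ _).1 (Phi'E x Wx) _ (divr_gt0 e0 C0).
exists (d / (`|K| + 1)); first by rewrite divr_gt0.
move=> _ [x' Wx' <-] xx'; rewrite !PsiK//.
have x'x : `|x' - x| < d.
  by rewrite (le_lt_trans (lip _ _ Wx' Wx))// mulrC -ltr_pdivlMr.
(* The remainder of [Psi] is minus [J x] applied to the remainder of [Phi]; the Lipschitz bound then
   turns the distance of the preimages into that of the images. *)
rewrite (_ : _ - _ = - J x (Phi x' - Phi x - Phi' x (x' - x))); last first.
  by rewrite (linearB (J x) _ (Phi' x (x' - x)))/= JP opprB.
rewrite normrN (@le_trans _ _ (2 * (e / (2 * (`|K| + 1)) * `|x' - x|)))//.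
  by rewrite ler_blin_le// hd.
rewrite (@le_trans _ _ (2 * (e / (2 * (`|K| + 1)) *
   ((`|K| + 1) * `|Phi x' - Phi x|))))//.
  rewrite ler_wpM2l// ler_wpM2l//; first by rewrite divr_ge0// ltW.
  exact: lip.
by rewrite le_eqVlt; apply/orP; left; apply/eqP; field; rewrite gt_eqF.
Qed.

End InverseSmooth.

Section HalfSpaceInverse.
Context {R : realType} {E : completeNormedModType R}.
Variables (l : E -> R) (W : set E) (Phi : E -> E) (Phi' : E -> blin E E).
Hypotheses (hl : half_form l) (oW : rel_open (halfspace l) W).

(* Solves [Phi x = y] in the whole space for the extension of [Phi] by
   [x |-> x + (Phi - id) (pi x)], where [pi] retracts onto the half space: as
   [Phi] maps the boundary into the boundary, a solution off the half space
   would have [l y < 0]. *)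
Theorem half_space_inverse x0 : W x0 ->
  (forall x, W x -> is_deriv W Phi x (Phi' x)) ->
  {within W, continuous Phi'} -> Phi' x0 = blin_id E ->
  (forall x, W x -> 0 <= l (Phi x)) ->
  (forall x, W x -> l x = 0 -> l (Phi x) = 0) ->
  exists W1, [/\ W1 `<=` W, W1 x0, rel_open (halfspace l) W1,
    rel_open (halfspace l) (Phi @` W1) &
    exists Psi, (forall x, W1 x -> Psi (Phi x) = x) /\
      forall n, Cn_on n W Phi -> Cn_on n (Phi @` W1) Psi].
Proof.
move=> Wx0 Phi'E /within_contP Phi'c Phi'x0 Phi_half Phi_bd.
have [pi [L [L1 pi_half pi_id pi_lip pi_neg]]] := half_form_retraction hl.
have L0 : 0 < L by rewrite (lt_le_trans _ L1).
(* A map with Lipschitz constant [q], precomposed with the [L]-Lipschitz retraction, has Lipschitz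
   constant 1/2. *)
pose q := (2 * L)^-1; have q0 : 0 < q by rewrite invr_gt0 mulr_gt0.
have qL : q * L = 2^-1 by rewrite /q; field; rewrite gt_eqF.
have q2 : q <= 2^-1 by rewrite -qL ler_peMr// ltW.
have /rel_openP[WH hW] := oW.
have [d1 d10 hd1] := hW x0 Wx0; have [d2 d20 hd2] := Phi'c x0 Wx0 _ q0.
pose d := Num.min d1 d2; have d0 : 0 < d by rewrite lt_min d10.
(* A half ball is convex, which the mean value inequality needs in order to make [Phi - id] a
   [q]-Lipschitz map. *)
pose V := [set x | 0 <= l x /\ `|x - x0| < d].
have VW : V `<=` W.
  by move=> x [lx]; rewrite lt_min => /andP[xd _]; exact: hd1.
have Vq x : V x -> `|Phi' x - blin_id E| <= q.
  move=> Vx; rewrite -Phi'x0; apply/ltW/hd2; first exact: VW.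
  by case: Vx => _; rewrite lt_min => /andP[].
have Vconv x y t : V x -> V y -> 0 <= t <= 1 -> V (x + t *: (y - x)).
  move=> [lx xd] [ly yd] /andP[t0 t1].
  have xyE z w : z + t *: (w - z) = (1 - t) *: z + t *: w.
    by rewrite scalerBr scalerBl scale1r; zmod.
  split.
    case: hl => [[lf _]|->]; last exact: ler01.
    rewrite xyE (functionalD _ _ lf) !(functionalZ _ _ lf).
    by rewrite addr_ge0// mulr_ge0// subr_ge0.
  rewrite (_ : _ - _ = (1 - t) *: (x - x0) + t *: (y - x0)); last first.
    rewrite !scalerBr !scalerBl !scale1r; zmod.
  rewrite (le_lt_trans (ler_normD _ _))// !normrZ (ger0_norm t0) ger0_norm ?subr_ge0//.
  have [->|t0'] := eqVneq t 0; first by rewrite subr0 mul1r mul0r addr0.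
  have {t0'}t0 : 0 < t by rewrite lt_neqAle eq_sym t0'.
  have -> : d = (1 - t) * d + t * d by ring.
  rewrite ler_ltD//; first by rewrite ler_wpM2l ?subr_ge0// ltW.
  by rewrite ltr_pM2l.
have Vlip x y : V x -> V y -> `|(Phi y - y) - (Phi x - x)| <= q * `|y - x|.
  move=> Vx Vy.
  pose g z := Phi z + - 1 *: blin_id E z.
  have -> : (Phi y - y) - (Phi x - x) = g y - g x by rewrite /g !scaleN1r.
  apply: (@mean_value_inequality _ _ _ V g
    (fun z => Phi' z + -1 *: blin_id E)).
  - by move=> t t01; exact: Vconv.
  - move=> z Vz; apply: is_derivD.
      by apply: (is_deriv_sub VW); apply: Phi'E; exact: VW.
    by apply: is_derivZ; exact: is_deriv_blin.
  - by move=> z Vz; rewrite scaleN1r; exact: Vq.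
have Vlow x y : V x -> V y -> `|x - y| <= 2 * `|Phi x - Phi y|.
  move=> Vx Vy; have h := Vlip _ _ Vy Vx.
  have h1 : `|x - y| <= `|Phi x - Phi y| + `|Phi x - x - (Phi y - y)|.
    rewrite (_ : x - y = (Phi x - Phi y) - (Phi x - x - (Phi y - y)));
      last by zmod.
    exact: ler_normB.
  have h2 : q * `|x - y| <= 2^-1 * `|x - y| by rewrite ler_wpM2r.
  lra.
(* [pi] multiplies distances to [x0] by at most [L], so it sends the closed ball of radius [r]
   within [d / 2] of [x0], inside [V]. *)
pose r := d / (2 * L); have r0 : 0 < r by rewrite divr_gt0// mulr_gt0.
have rL : L * r = d / 2 by rewrite /r; field; rewrite gt_eqF.
have rd : r < d by rewrite ltr_pdivrMr ?mulr_gt0// ltr_pMr//; lra.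
have lx0 : 0 <= l x0 := WH _ Wx0.
have pi_ball x : `|x - x0| <= r -> V (pi x).
  move=> xr; split=> //; rewrite -[X in _ - X]pi_id// (le_lt_trans (pi_lip _ _))//.
  rewrite (@le_lt_trans _ _ (L * r))//; first by rewrite ler_wpM2l// ltW.
  by rewrite rL ltr_pdivrMr// ltr_pMr//; lra.
have solve y : 0 <= l y -> `|y - Phi x0| <= 2^-1 * r ->
    exists2 x, V x & Phi x = y.
  move=> ly yr.
  have [| | |x xr xy] := @lipschitz_perturbation_solve _ _
      (fun x => Phi (pi x) - pi x) x0 r y.
  - exact: ltW.
  - move=> x x' xr x'r; rewrite (le_trans (Vlip _ _ (pi_ball _ x'r) (pi_ball _ xr)))//.
    rewrite -qL -mulrA ler_wpM2l// ?(ltW q0)//; exact: pi_lip.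
  - by rewrite pi_id// (addrC x0) subrK.
  - have [lx|lx] := leP 0 (l x).
      exists x; last by rewrite -xy pi_id// addrC subrK.
      by split=> //; exact: le_lt_trans xr rd.
    exfalso; case: hl lx => [[lf _] lx|->]; last by rewrite ltr10.
    move: ly; rewrite -xy (functionalD _ _ lf) (functionalB _ _ lf) (pi_neg _ lx) subr0.
    rewrite Phi_bd ?addr0 ?pi_neg//; last exact/VW/pi_ball.
    by rewrite leNgt lx.
pose W1 := [set x | V x /\ `|Phi x - Phi x0| < 2^-1 * r].
have hr0 : 0 < 2^-1 * r by rewrite mulr_gt0// invr_gt0.
have Vx0 : V x0 by split=> //; rewrite subrr normr0.
have W1W : W1 `<=` W by move=> x [/VW].
have oW1 : rel_open (halfspace l) W1.
  apply/rel_openP; split=> [x [[]]//|x [Vx Phix]].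
  have r1 : 0 < 2^-1 * r - `|Phi x - Phi x0| by rewrite subr_gt0.
  have [d3 d30 hd3] := is_deriv_cont (Phi'E _ (VW _ Vx)) r1.
  have xd : 0 < d - `|x - x0| by rewrite subr_gt0; case: Vx.
  exists (Num.min d3 (d - `|x - x0|)); first by rewrite lt_min d30.
  move=> y ly; rewrite lt_min => /andP[y3 yd].
  have Vy : V y.
    split=> //; rewrite -(subrK x y) -addrA (le_lt_trans (ler_normD _ _))//.
    by rewrite -ltrBrDr.
  split=> //; have := hd3 y (VW _ Vy) y3; rewrite ltrBrDr => /(le_lt_trans _); apply.
  by rewrite -[X in `|X| <= _](subrKA (Phi x)) ler_normD.
have PhiW1 : Phi @` W1 = [set y | 0 <= l y /\ `|y - Phi x0| < 2^-1 * r].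
  apply/seteqP; split=> [_ [x [Vx Phix] <-]|y [ly yr]].
    by split=> //; apply: Phi_half; exact: VW.
  by have [x Vx xy] := solve y ly (ltW yr); exists x => //; split=> //; rewrite xy.
have inj x x' : W1 x -> W1 x' -> Phi x = Phi x' -> x = x'.
  move=> [Vx _] [Vx' _] xx'; apply/eqP; rewrite -subr_eq0 -normr_le0.
  by rewrite (le_trans (Vlow _ _ Vx Vx'))// xx' subrr normr0 mulr0.
pose Psi y := xget x0 [set x | W1 x /\ Phi x = y].
have PsiK x : W1 x -> Psi (Phi x) = x.
  by move=> W1x; apply: xget_unique => // x' [W1x' xx']; exact: inj.
exists W1; split=> //.
- by split=> //; rewrite subrr normr0.
- rewrite PhiW1; apply/rel_openP; split=> [y []//|y [ly yr]].
  exists (2^-1 * r - `|y - Phi x0|); rewrite ?subr_gt0// => z lz zy; split=> //.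
  rewrite -(subrK y z) -addrA (le_lt_trans (ler_normD _ _))//.
  by rewrite -ltrBrDr.
- exists Psi; split=> // n Phin.
  apply: (@Cn_on_inverse _ _ l W1 Phi Phi' hl oW1 Psi 2) => //.
  - by move=> x x' [Vx _] [Vx' _]; exact: Vlow.
  - by move=> x W1x; apply: (is_deriv_sub W1W); exact/Phi'E/W1W.
  - by move=> x [Vx _]; exact: le_trans (Vq _ Vx) q2.
  - exact: Cn_on_sub Phin.
Qed.

End HalfSpaceInverse.

(** * Open mappings and complemented subspaces *)

Section ProductComplete.
Context {R : realType} {E F : completeNormedModType R}.

(** The product of a closed subspace and its closed complement is thereby a Banach space, so the
    open mapping theorem applies to the addition map. *)
Lemma prod_complete (G : set_system ((E * F)%type : normedModType R)) :
  ProperFilter G -> cauchy G -> cvg G.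
Proof.
move=> GG Gc.
have c1 : cvg (fst @ G).
  apply: cauchy_cvg; apply/cauchy_ballP => e e0.
  have /cauchy_ballP/(_ e e0)[[A B] /= [GA GB] AB] := Gc.
  exists (fst @` A, fst @` B) => /=.
    split; rewrite nbhs_simpl/=.
      by apply: filterS GA => x Ax; exists x.
    by apply: filterS GB => x Bx; exists x.
  by case=> _ _ [/= [a Aa <-] [b Bb <-]]; have [] := AB (a, b) (conj Aa Bb).
have c2 : cvg (snd @ G).
  apply: cauchy_cvg; apply/cauchy_ballP => e e0.
  have /cauchy_ballP/(_ e e0)[[A B] /= [GA GB] AB] := Gc.
  exists (snd @` A, snd @` B) => /=.
    split; rewrite nbhs_simpl/=.
      by apply: filterS GA => x Ax; exists x.
    by apply: filterS GB => x Bx; exists x.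
  by case=> _ _ [/= [a Aa <-] [b Bb <-]]; have [] := AB (a, b) (conj Aa Bb).
apply/cvg_ex; exists (lim (fst @ G), lim (snd @ G)).
have := cvg_pair c1 c2.
by under eq_fun do rewrite -surjective_pairing; move=> h; exact: h.
Qed.

HB.instance Definition _ := Uniform_isComplete.Build (E * F)%type prod_complete.

End ProductComplete.

Section OpenMapping.
Context {R : realType} {E F : completeNormedModType R}.

Lemma Baire_cover (A : nat -> set F) : \bigcup_n A n = setT ->
  exists n y0 r, 0 < r /\ forall y, `|y - y0| < r -> closure (A n) y.
Proof.
move=> AT; apply: contrapT => hA.
have : forall n, open (~` closure (A n)) /\ dense (~` closure (A n)).
  move=> n; split; first by rewrite openC; exact: closed_closure.
  move=> D [y0 Dy0] oD; apply: contrapT => hD; apply: hA.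
  have /nbhs_normP[r /= r0 hr] : nbhs y0 D by exact: open_nbhs_nbhs.
  exists n, y0, r; split=> // y yr; apply: contrapT => nA; apply: hD.
  by exists y; split=> //; apply: hr; rewrite /ball_ /= distrC.
move=> /Baire/(_ setT) h; have [|y [_ hy]] := h _ openT; first by exists 0.
have : (\bigcup_n A n) y by rewrite AT.
by move=> [n _ Any]; apply: (hy n I); exact: subset_closure.
Qed.

Variable T : blin E F.
Hypothesis T_surj : forall y, exists x, T x = y.

(** Baire provides a ball with unknown centre [y0] in the closure of the image of a ball;
    subtracting two approximate preimages removes the centre. *)
Lemma approx_preimage : exists2 C, 0 <= C & forall y, exists x,
  `|x| <= C * `|y| /\ `|y - T x| <= 2^-1 * `|y|.
Proof.
have [|n [y0 [r [r0 hr]]]] := @Baire_cover (fun n => T @` [set x | `|x| <= n%:R]).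
  apply/seteqP; split=> // y _; have [x Tx] := T_surj y.
  exists (Num.truncn `|x|).+1 => //; exists x => //=.
  by rewrite ltW// truncnS_gt.
have near_preimage y e : `|y - y0| < r -> 0 < e ->
    exists x, `|x| <= n%:R /\ `|y - T x| < e.
  move=> /hr yA e0; have [_ [[x /= xn <-]]] := yA _ (nbhsx_ballx y e e0).
  by rewrite -ball_normE /= => yx; exists x.
exists (4 * n%:R / r); first by rewrite divr_ge0// ?ltW// mulr_ge0.
move=> y; have [->|y_neq0] := eqVneq y 0.
  by exists 0; rewrite linear0 subrr !normr0 !mulr0.
have y_gt0 : 0 < `|y| by rewrite normr_gt0.
(* [c *: y] has norm [r / 2], hence stays in the ball once added to [y0]. Two errors of
   [c * |y| / 4] add up to half of [c * |y|], and the bound [2 n] on the difference of preimages,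
   divided by [c], gives the constant [4 n / r]. *)
pose c := r / (2 * `|y|); have c0 : 0 < c by rewrite divr_gt0// mulr_gt0.
have e0 : 0 < c * `|y| / 4 by rewrite divr_gt0// mulr_gt0.
have cy : c * `|y| = r / 2 by rewrite /c; field; rewrite gt_eqF.
have [|x1 [x1n Tx1]] := near_preimage (y0 + c *: y) _ _ e0.
  rewrite [y0 + _]addrC addrK normrZ gtr0_norm// cy.
  by rewrite ltr_pdivrMr// ltr_pMr//; lra.
have [|x2 [x2n Tx2]] := near_preimage y0 _ _ e0; first by rewrite subrr normr0.
exists (c^-1 *: (x1 - x2)); split.
  rewrite normrZ normfV gtr0_norm// ler_pdivrMl//.
  rewrite (_ : c * _ = n%:R + n%:R); last first.
    by rewrite /c; field; rewrite !gt_eqF.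
  by rewrite (le_trans (ler_normB _ _))// lerD.
rewrite -(ler_pM2l c0) -[X in X * `|y - _|]gtr0_norm// -normrZ scalerBr.
rewrite -linearZ/= scalerA divff ?gt_eqF// scale1r (linearB T)/=.
rewrite (_ : _ - _ = (y0 + c *: y - T x1) - (y0 - T x2)); last by zmod.
rewrite (le_trans (ler_normB _ _))// (le_trans (lerD (ltW Tx1) (ltW Tx2)))//.
by rewrite le_eqVlt; apply/orP; left; apply/eqP; field.
Qed.

(** Each approximate preimage halves the remainder. The successive corrections are dominated by a
    geometric series of ratio 1/2, whose sum accounts for the factor 2. *)
Theorem open_mapping : exists2 C, 0 <= C &
  forall y, exists x, T x = y /\ `|x| <= C * `|y|.
Proof.
have [C C0 /choice[s hs]] := approx_preimage.
exists (C * 2); first by rewrite mulr_ge0.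
move=> y; pose rem n := iter n (fun z => z - T (s z)) y.
have rem_le n : `|rem n| <= 2^-1 ^+ n * `|y|.
  elim: n => [|n IH]; first by rewrite expr0 mul1r.
  rewrite exprS -mulrA (le_trans (hs (rem n)).2)//.
  by rewrite ler_wpM2l.
pose u n := s (rem n).
have u_le n : `|u n| <= geometric (C * `|y|) 2^-1 n.
  rewrite /geometric/= (le_trans (hs _).1)// -mulrA ler_wpM2l// mulrC.
  exact: rem_le.
have half1 : `|2^-1 : R| < 1 by rewrite ger0_norm//; lra.
have geo_cvg := @is_cvg_geometric_series R (C * `|y|) _ half1.
have ncvg : cvgn [normed series u].
  apply: series_le_cvg u_le geo_cvg => // n.
  by rewrite /geometric/= mulr_ge0// ?mulr_ge0// exprn_ge0.
have ucvg := normed_cvg ncvg.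
exists (limn (series u)); split.
  have Tsum n : T (series u n) = y - rem n.
    elim: n => [|n IH].
      by rewrite /series/= big_geq// linear0 subrr.
    rewrite seriesEnat/= big_nat_recr//= linearD/= -[X in T X]/(series u n) IH.
    by rewrite /u; zmod.
  have c1 : T (series u n) @[n --> \oo] --> T (limn (series u)).
    by apply: continuous_cvg ucvg; exact: blin_continuous.
  have c2 : T (series u n) @[n --> \oo] --> y - 0.
    under eq_fun do rewrite Tsum.
    apply: cvgB; first exact: cvg_cst.
    apply/norm_cvg0P.
    apply: (@squeeze_cvgr _ _ _ _ (cst 0) (geometric `|y| 2^-1)).
    - by apply: nearW => n; rewrite normr_ge0/= mulrC rem_le.
    - exact: cvg_cst.
    - exact: cvg_geometric.
  rewrite -(cvg_lim (@norm_hausdorff _ _) c1) (cvg_lim (@norm_hausdorff _ _) c2).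
  by rewrite subr0.
rewrite (le_trans (lim_series_norm ncvg))//.
rewrite (le_trans (lim_series_le ncvg geo_cvg u_le))//.
rewrite (cvg_lim _ (@cvg_geometric_series R (C * `|y|) _ half1))//.
by rewrite le_eqVlt; apply/orP; left; apply/eqP; field.
Qed.

End OpenMapping.

Section Complements.
Context {R : realType}.
Implicit Types E F G : completeNormedModType R.

Lemma bounded_inverse E F (T : blin E F) :
  (forall y, exists x, T x = y) -> (forall x, T x = 0 -> x = 0) ->
  exists S : blin F E, (forall y, T (S y) = y) /\ (forall x, S (T x) = x).
Proof.
move=> surj ker0; have [C C0 hC] := open_mapping surj.
have inj x x' : T x = T x' -> x = x'.
  move=> xx'; apply/eqP; rewrite -subr_eq0; apply/eqP/ker0.
  by rewrite (linearB T)/= xx' subrr.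
have [S hS] := choice hC.
have TS y : T (S y) = y by have [] := hS y.
have Sb : S \in @blin_pred R F E.
  apply: blin_predP => [a x y|]; first by apply: inj; rewrite TS (linearP T)/= !TS.
  by exists C => y; have [] := hS y.
by exists (Blin Sb); split=> // x; apply: inj; rewrite TS.
Qed.

Lemma cs_inc_subproof E (K : csubspace E) :
  @cs_val R E K \in @blin_pred R (cs_type K) E.
Proof. by apply: blin_predP => //; exists 1 => x; rewrite mul1r. Qed.

Definition cs_inc E (K : csubspace E) : blin (cs_type K) E :=
  Blin (cs_inc_subproof K).

Lemma cs_valP E (K : csubspace E) (k : cs_type K) : cs_set K (cs_val k).
Proof. by case: k => x /= /set_mem. Qed.

Lemma cs_val_surj E (K : csubspace E) x :
  cs_set K x -> exists k : cs_type K, cs_val k = x.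
Proof. by move=> Kx; exists (CsElt (mem_set Kx)). Qed.

Lemma cs_setB E (K : csubspace E) x y :
  cs_set K x -> cs_set K y -> cs_set K (x - y).
Proof. by move=> Kx Ky; rewrite addrC -scaleN1r; exact: cs_setD. Qed.

Lemma blin_ker_subproof E F (S : blin E F) : closed [set x | S x = 0].
Proof.
rewrite (_ : [set x | S x = 0] = S @^-1` [set 0])//.
apply: closed_comp => [x _|]; first exact: blin_continuous.
by apply: accessible_closed_set1; apply: hausdorff_accessible; exact: norm_hausdorff.
Qed.

Definition blin_ker E F (S : blin E F) : csubspace E.
Proof.
apply: (@CSubspace R E [set x | S x = 0]).
- exact: linear0.
- by move=> a x y /= x0 y0; rewrite (linearP S)/= x0 y0 scaler0 addr0.
- exact: blin_ker_subproof.
Defined.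

Definition cs_preimage E F (S : blin E F) (K : csubspace F) : csubspace E.
Proof.
apply: (@CSubspace R E (S @^-1` K)).
- by rewrite /preimage/= linear0; exact: cs_set0.
- by move=> a x y /= x0 y0; rewrite /= (linearP S)/=; exact: cs_setD.
- by apply: closed_comp => [x _|]; [exact: blin_continuous|exact: cs_closed].
Defined.

Lemma complement_preimage E F (T : blin E F) (T' : blin F E) (A : set E) :
  (forall x, T' (T x) = x) -> (forall y, T (T' y) = y) ->
  has_closed_complement A -> has_closed_complement (T' @^-1` A).
Proof.
move=> T'T TT' [G [AG AGT]]; exists (cs_preimage T' G); split.
  apply/seteqP; split=> [y [/= Ay Gy]|y /= ->].
    have : (A `&` G) (T' y) by [].
    by rewrite AG /= => y0; rewrite -(TT' y) y0 linear0.
  have : (A `&` G) 0 by rewrite AG.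
  by rewrite /preimage/= linear0.
apply/seteqP; split=> // y _; have : [set a + g | a in A & g in G] (T' y).
  by rewrite AGT.
case=> a Aa [g Gg agy]; exists (T a); rewrite /= ?T'T//.
by exists (T g); rewrite /= ?T'T// -linearD/= agy TT'.
Qed.

(** Addition from the product of [K] and its complement is a bounded bijection; the first component
    of its inverse is the projection. *)
Lemma complement_projection E (K : csubspace E) : has_closed_complement K ->
  exists P : blin E (cs_type K), forall k, P (cs_val k) = k.
Proof.
move=> [G [KG KGT]].
pose add (z : (cs_type K * cs_type G)%type) := cs_val z.1 + cs_val z.2.
have addb : add \in @blin_pred R (cs_type K * cs_type G)%type E.
  apply: blin_predP => [a x y|].
    by rewrite /add/= scalerDr addrACA.
  exists 2 => -[k g]; rewrite /add/= (le_trans (ler_normD _ _))//.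
  by rewrite mulr_natl mulr2n lerD// prod_normE/= le_max -!cs_normE lexx ?orbT.
have [||S [TS ST]] := @bounded_inverse _ E (Blin addb).
- move=> y; have : [set a + g | a in K & g in G] y by rewrite KGT.
  move=> [a /cs_val_surj[k <-] [g /cs_val_surj[h <-] <-]].
  by exists (k, h).
- move=> [k g] /= /eqP; rewrite /add/= addr_eq0 => /eqP kg.
  have : (K `&` G) (cs_val k).
    split; first exact: cs_valP.
    by rewrite kg -sub0r; apply: cs_setB; [exact: cs_set0|exact: cs_valP].
  rewrite KG /= => k0; have g0 : cs_val g = 0 by apply: oppr_inj; rewrite -kg oppr0.
  by congr (_, _); exact: val_inj.
have Pb : (fun x => (S x).1) \in @blin_pred R E (cs_type K).
  apply: blin_predP => [a x y|]; first by rewrite (linearP S).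
  exists `|S| => x; rewrite (le_trans _ (ler_blin S x))//.
  by rewrite prod_normE/= le_max lexx.
exists (Blin Pb) => k /=.
by rewrite (_ : cs_val k = Blin addb (k, 0)) ?ST//= /add/= addr0.
Qed.

(** Restricted to a complement of its kernel, [S] is a bounded bijection onto [F]. *)
Lemma bounded_right_inverse E F (S : blin E F) :
  (forall y, exists x, S x = y) -> has_closed_complement [set x | S x = 0] ->
  exists B : blin F E, forall y, S (B y) = y.
Proof.
move=> surj [G [KG KGT]].
have [||B [SB _]] := @bounded_inverse _ _ (blin_comp S (cs_inc G)).
- move=> y; have [x <-] := surj y.
  have : [set a + g | a in [set x | S x = 0] & g in G] x by rewrite KGT.
  move=> [a /= Sa [g /cs_val_surj[h <-] <-]]; exists h => /=.
  by rewrite (linearD S)/= Sa add0r.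
- move=> g /= Sg; have : ([set x | S x = 0] `&` G) (cs_val g).
    by split=> //; exact: cs_valP.
  by rewrite KG /= => g0; exact: val_inj.
by exists (blin_comp (cs_inc G) B).
Qed.

End Complements.

(** * Straightening a submersion *)

Section CpMaps.
Context {R : realType}.
Implicit Types (p : option nat) (E F G : normedModType R).

Definition ord_le (n : nat) p : bool := if p is Some m then (n <= m)%N else true.

(** Finite and infinite [p] are treated alike: the rules below follow order by order from those for
    [Cn_on]. *)
Lemma Cp_onP p E F (W : set E) (h : E -> F) :
  Cp_on p W h <-> forall n, ord_le n p -> Cn_on n W h.
Proof.
case: p => [m|] /=; last by split=> h' n; [move=> _|]; exact: h'.
split=> [hm n|hm]; last by apply: hm; rewrite leqnn.
elim: m hm => [|m IH] hm; first by rewrite leqn0 => /eqP ->.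
by rewrite leq_eqVlt => /orP[/eqP ->//|]; apply: IH; exact: Cn_onS.
Qed.

Lemma Cp_on_ext p E F (W : set E) (h k : E -> F) :
  (forall y, W y -> h y = k y) -> Cp_on p W h -> Cp_on p W k.
Proof. by move=> hk /Cp_onP hp; apply/Cp_onP => n /hp; exact: Cn_on_ext. Qed.

Lemma Cp_on_sub p E F (W V : set E) (h : E -> F) :
  V `<=` W -> Cp_on p W h -> Cp_on p V h.
Proof. by move=> VW /Cp_onP hp; apply/Cp_onP => n /hp; exact: Cn_on_sub. Qed.

Lemma Cp_on_comp p E F G (W : set E) (V : set F) (f : E -> F) (g : F -> G) :
  (forall x, W x -> V (f x)) -> Cp_on p W f -> Cp_on p V g ->
  Cp_on p W (g \o f).
Proof.
move=> WV /Cp_onP fp /Cp_onP gp; apply/Cp_onP => n np.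
by apply: Cn_on_comp WV (fp n np) (gp n np).
Qed.

Lemma Cp_on_blin p E F (W : set E) (u : blin E F) : Cp_on p W u.
Proof. by apply/Cp_onP => n _; exact: Cn_on_blin. Qed.

Lemma Cp_on_id p E (W : set E) : Cp_on p W (fun x => x).
Proof. exact: (Cp_on_blin p W (blin_id E)). Qed.

Lemma Cp_on_cst p E F (W : set E) (b : F) : Cp_on p W (fun=> b).
Proof. by apply/Cp_onP => n _; exact: Cn_on_cst. Qed.

Lemma Cp_onD p E F (W : set E) (h k : E -> F) :
  Cp_on p W h -> Cp_on p W k -> Cp_on p W (fun x => h x + k x).
Proof.
by move=> /Cp_onP hp /Cp_onP kp; apply/Cp_onP => n np; apply: Cn_onD; auto.
Qed.

Lemma Cp_on_cont p E F (W : set E) (h : E -> F) :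
  Cp_on p W h -> {within W, continuous h}.
Proof.
by case: p => [n|/(_ 0%N)//] /=; exact: Cn_on_cont.
Qed.

Lemma Cp_on_C1 p E F (W : set E) (h : E -> F) : p <> Some 0%N ->
  Cp_on p W h -> exists2 h' : E -> blin E F,
    (forall x, W x -> is_deriv W h x (h' x)) & {within W, continuous h'}.
Proof.
move=> p0 /Cp_onP/(_ 1%N)[|h' [hh' h'c]]; last by exists h'.
by case: p p0 => [[|]|].
Qed.

End CpMaps.

Section Straightening.
Context {R : realType} {E F : completeNormedModType R}.

(** A first-order condition at a minimum of [l \o h], one-sided because only directions staying in
    [W] can be tested. *)
Lemma functional_deriv_ge0 (W : set E) (h : E -> F) x u z (l : F -> R) :
  functional l -> is_deriv W h x u ->
  (exists2 d, 0 < d & forall t, 0 < t -> t < d -> W (x + t *: z)) ->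
  l (h x) = 0 -> (forall y, W y -> 0 <= l (h y)) -> 0 <= l (u z).
Proof.
move=> lf hu dir lx lW; have [M M0 lM] := functional_bound lf.
have M1 : 0 < M + 1 by rewrite ltr_wpDl.
apply/ler_addgt0Pr => e e0.
have [t [t0 Wt ht]] := is_deriv_dir hu dir (divr_gt0 e0 M1).
have := lW _ Wt; set y := h _ in ht * => ly.
have : l (t *: u z) = l y - l (y - h x - t *: u z).
  by rewrite !(functionalB _ _ lf) lx; ring.
rewrite (functionalZ _ _ lf) => E1.
have h2 : l (y - h x - t *: u z) <= e * t.
  rewrite (le_trans (ler_norm _))// (le_trans (lM _))//.
  rewrite (@le_trans _ _ ((M + 1) * (e / (M + 1) * t)))//.
    by rewrite ler_pM// lerDl.
  by rewrite mulrA mulrCA divff ?gt_eqF// mulr1.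
rewrite -(ler_pM2l t0) mulr0 mulrDr E1; lra.
Qed.

Lemma functional_opp (l : F -> R) : functional l -> functional (fun y => - l y).
Proof.
move=> [ll lc]; split=> [a x y|x]; first by rewrite ll opprD mulrN.
by apply: (@cvgN _ R^o); exact: lc.
Qed.

Lemma functional_deriv_eq0 (W : set E) (h : E -> F) x u z (l : F -> R) :
  functional l -> is_deriv W h x u ->
  (exists2 d, 0 < d & forall t, 0 < t -> t < d -> W (x + t *: z)) ->
  l (h x) = 0 -> (forall y, W y -> l (h y) = 0) -> l (u z) = 0.
Proof.
move=> lf hu dir lx lW; apply/eqP; rewrite eq_le; apply/andP; split.
  rewrite -oppr_ge0.
  apply: (functional_deriv_ge0 (functional_opp lf) hu dir).
    by rewrite lx oppr0.
  by move=> y /lW ->; rewrite oppr0.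
by apply: (functional_deriv_ge0 lf hu dir) => // y /lW ->.
Qed.

Variables (p : option nat) (l : E -> R) (l' : F -> R) (W : set E) (h : E -> F).
Variables (z0 : E) (u : blin E F).
Hypotheses (p0 : p <> Some 0%N) (hl : half_form l).
Hypotheses (oW : rel_open (halfspace l) W) (Wz0 : W z0).
Hypotheses (hp : Cp_on p W h) (hu : is_deriv W h z0 u).
Hypothesis u_surj : forall y, exists x, u x = y.

(* [l' \o u] vanishes on [ker l], hence is a multiple of [l]. *)
Lemma boundary_proportional : functional l -> (exists v, l v != 0) ->
  functional l' -> (exists w, l' w != 0) -> l z0 = 0 ->
  (forall z, W z -> 0 <= l' (h z)) ->
  (forall z, W z -> l z = 0 -> l' (h z) = 0) ->
  exists2 a, 0 < a & forall x, l' (u x) = a * l x.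
Proof.
move=> lf [v lv] lf' [w lw] lz0 l'_ge0 l'_bd.
have l'z0 : l' (h z0) = 0 by exact: l'_bd.
have ker x : l x = 0 -> l' (u x) = 0.
  (* On the boundary part of [W] the function [l' \o h] is identically 0, and directions in the
     kernel of [l] stay in that part. *)
  move=> lx; pose V := W `&` [set z | l z = 0].
  have hV : is_deriv V h z0 u by apply: is_deriv_sub hu => z [].
  apply: (functional_deriv_eq0 lf' hV) => //; last by move=> y [Wy ly]; exact: l'_bd.
  have [|d d0 hd] := rel_open_dir (z := x) hl oW Wz0; first by rewrite lx.
  exists d => // t t0 td; split; first exact: hd.
  by rewrite /= (functionalD _ _ lf) (functionalZ _ _ lf) lz0 lx mulr0 addr0.
(* With [v] pointing inward, the first-order condition shows that [a] is nonnegative. *)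
wlog lv0 : v lv / 0 < l v.
  move=> hw; have [|lvn] := ltP 0 (l v); first exact: hw.
  apply: (hw (- v)); rewrite (functionalN _ lf) ?oppr_eq0//.
  by rewrite oppr_gt0 lt_neqAle lv.
pose a := l' (u v) / l v.
have prop x : l' (u x) = a * l x.
  have /ker : l (x - (l x / l v) *: v) = 0.
    by rewrite (functionalB _ _ lf) (functionalZ _ _ lf) divfK// subrr.
  rewrite (linearB u)/= (functionalB _ _ lf') linearZ/= (functionalZ _ _ lf').
  move=> /eqP; rewrite subr_eq0 => /eqP ->.
  by rewrite /a; field.
have a_ge0 : 0 <= a.
  apply: divr_ge0; last exact: ltW.
  apply: (functional_deriv_ge0 lf' hu) => //.
  by apply: rel_open_dir hl oW Wz0 _; exact: ltW.
exists a => //; rewrite lt_neqAle a_ge0 andbT eq_sym.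
apply/eqP => a0; have [x ux] := u_surj w.
by move: lw; rewrite -ux prop a0 mul0r eqxx.
Qed.

Lemma straighten : has_closed_complement [set x | u x = 0] ->
  l = cst 1 \/ (exists2 a, 0 < a & forall x, l' (u x) = a * l x) /\
    [/\ functional l, functional l', l z0 = 0,
      forall z, W z -> 0 <= l' (h z) &
      forall z, W z -> l z = 0 -> l' (h z) = 0] ->
  exists W1 Phi Psi,
  [/\ [/\ W1 `<=` W, W1 z0, rel_open (halfspace l) W1 &
        rel_open (halfspace l) (Phi @` W1)],
      forall z, W1 z -> Psi (Phi z) = z,
      Cp_on p W1 Phi /\ Cp_on p (Phi @` W1) Psi,
      Phi z0 = 0 /\ (forall z, u (Phi z) = h z - h z0) &
      l = cst 1 \/ forall k, u k = 0 -> l k = 0].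
Proof.
move=> u_compl hbd; have [B uB] := bounded_right_inverse u_surj u_compl.
have [h' hh' h'c] := Cp_on_C1 p0 hp.
have h'z0 : h' z0 = u by apply: is_deriv_unique hl oW Wz0 (hh' _ Wz0) hu.
pose P : blin E E := blin_id E - blin_comp B u.
have PE x : P x = x - B (u x) by [].
have uP x : u (P x) = 0 by rewrite PE (linearB u)/= uB subrr.
(* Constants are split off so that the closure rules for C^p maps apply; [PhiE] recovers the form
   centred at [z0]. *)
pose Phi z := (P z + B (h z)) + (- P z0 - B (h z0)).
have PhiE z : Phi z = P (z - z0) + B (h z - h z0).
  by rewrite (linearB P) (linearB B) /Phi; zmod.
pose Phi' z := P + bbil_comp E F E B (h' z).
have Phi_cp : Cp_on p W Phi.
  apply: Cp_onD; last exact: Cp_on_cst.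
  apply: Cp_onD; first exact: Cp_on_blin.
  by apply: (@Cp_on_comp _ _ _ _ _ _ setT) => //; exact: Cp_on_blin.
have uPhi z : u (Phi z) = h z - h z0 by rewrite PhiE (linearD u)/= uP add0r uB.
have Phi_half : l = cst 1 \/ [/\ functional l,
    forall z, W z -> 0 <= l (Phi z), forall z, W z -> l z = 0 -> l (Phi z) = 0 &
    forall k, u k = 0 -> l k = 0].
  case: hbd => [->|[[a a0 ha] [lf lf' lz0 l'_ge0 l'_bd]]]; first by left.
  have lE x : l x = l' (u x) / a by rewrite ha mulrC mulKf// gt_eqF.
  have lPhi z : l (Phi z) = l' (h z) / a.
    by rewrite lE uPhi (functionalB _ _ lf') (l'_bd z0)// subr0.
  right; split=> //.
  - by move=> z Wz; rewrite lPhi divr_ge0 ?l'_ge0// ltW.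
  - by move=> z Wz lz; rewrite lPhi l'_bd// mul0r.
  - by move=> k uk; rewrite lE uk (functional0 lf') mul0r.
have [||||| W1 [W1W W1z0 oW1 oPhi [Psi [PsiK Psi_cn]]]] :=
  @half_space_inverse _ _ l W Phi Phi' hl oW z0 Wz0.
- move=> z Wz; rewrite -[Phi' z]addr0.
  apply: is_derivD; last exact: is_deriv_cst.
  apply: is_derivD; first exact: is_deriv_blin.
  rewrite bbil_compE.
  by apply: (@is_deriv_comp _ _ _ _ W setT) (hh' _ Wz) _ => //; exact: is_deriv_blin.
- apply: (@Cn_onD _ 0); first exact: (Cn_on_cst 0).
  by apply: (@Cn_on_bbil _ 0) h'c; exact: (Cn_on_cst 0).
(* At [z0] the derivative is [P] plus [B] after [u], which is the identity by the choice of [P]. *)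
- rewrite /Phi' h'z0 bbil_compE /P; apply: blinP => x.
  by rewrite blinDE blinBE /=; zmod.
- by move=> z Wz; case: Phi_half => [->|[_ + _ _]]; [exact: ler01|exact].
- move=> z Wz; case: Phi_half => [->|[_ _ + _]]; last exact.
  by rewrite /cst => /eqP; rewrite oner_eq0.
exists W1, Phi, Psi; split=> //.
- split; first exact: Cp_on_sub Phi_cp.
  by apply/Cp_onP => n np; apply: Psi_cn; exact: (Cp_onP _ _ _).1 Phi_cp n np.
- by split=> //; rewrite PhiE !subrr !linear0 addr0.
- by case: Phi_half => [->|[]]; [left|right].
Qed.

End Straightening.

(** * Charts of manifolds with boundary *)

Section RelOpen.
Context {R : realType}.
Implicit Types E F : normedModType R.

Lemma rel_open_preimage E F (H W : set E) (H' V : set F) (h : E -> F) :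
  rel_open H W -> {within W, continuous h} -> rel_open H' V ->
  (forall x, W x -> H' (h x)) -> rel_open H (W `&` h @^-1` V).
Proof.
move=> /rel_openP[WH oW] /within_contP hc /rel_openP[_ oV] WH'.
apply/rel_openP; split=> [x [/WH]//|x [Wx Vhx]].
have [d d0 hd] := oW x Wx; have [e e0 he] := oV _ Vhx.
have [d' d'0 hd'] := hc x Wx e e0.
exists (Num.min d d'); first by rewrite lt_min d0.
move=> y Hy; rewrite lt_min => /andP[yd yd'].
have Wy := hd y Hy yd; split=> //; apply: he; first exact: WH'.
exact: hd'.
Qed.

Lemma rel_openI E (H V W : set E) :
  rel_open H V -> rel_open H W -> rel_open H (V `&` W).
Proof.
move=> [U oU ->] [U' oU' ->]; exists (U `&` U'); first exact: openI.
by rewrite setIACA setIid.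
Qed.

(** Differentiability is local: relative openness of [S] supplies the radius within which points of
    [W] belong to [S]. *)
Lemma is_deriv_nbhs E F (H W S : set E) (h : E -> F) x u :
  rel_open H S -> W `<=` H -> S x -> is_deriv S h x u -> is_deriv W h x u.
Proof.
move=> /rel_openP[_ oS] WH Sx /is_derivP hu; apply/is_derivP => e e0.
have [d d0 hd] := hu e e0; have [d' d'0 hd'] := oS x Sx.
exists (Num.min d d'); first by rewrite lt_min d0.
move=> y Wy; rewrite lt_min => /andP[yd yd']; apply: hd => //.
by apply: hd' => //; exact: WH.
Qed.

End RelOpen.

Section ChartImages.
Context {R : realType} {X : Type}.
Implicit Types (c d : prechart R X) (V : set X).

Lemma chart_invK c x : is_chart c -> chart_dom c x ->
  chart_inv c (chart_map c x) = x.
Proof. by move=> [_ h _]; exact: h. Qed.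

Lemma chart_image_half c z : is_chart c -> chart_image c z -> chart_half c z.
Proof. by move=> [_ _ /rel_openP[h _]]; exact: h. Qed.

Lemma chart_imageP c z : is_chart c -> chart_image c z ->
  chart_dom c (chart_inv c z) /\ chart_map c (chart_inv c z) = z.
Proof. by move=> ch [x cx <-]; rewrite chart_invK. Qed.

Lemma chart_imageE c V z : is_chart c ->
  (chart_map c @` (chart_dom c `&` V)) z <->
  chart_image c z /\ V (chart_inv c z).
Proof.
move=> ch; split=> [[x [cx Vx] <-]|[cz Vz]].
  by rewrite chart_invK//; split=> //; exists x.
by have [h1 h2] := chart_imageP ch cz; exists (chart_inv c z).
Qed.

(** [deriv] selects a derivative by choice. To compute it, a derivative on some smaller relatively
    open set suffices, by locality and uniqueness. *)
Lemma deriv_in_unique (X' : Type) c (d : prechart R X') (f : X -> X') x S u :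
  is_chart c -> rel_open (chart_half c) S -> S (chart_map c x) ->
  S `<=` chart_map c @` (chart_dom c `&` f @^-1` chart_dom d) ->
  is_deriv S (chart_map d \o f \o chart_inv c) (chart_map c x) u ->
  deriv_in c d f x = u /\
  is_deriv (chart_map c @` (chart_dom c `&` f @^-1` chart_dom d))
    (chart_map d \o f \o chart_inv c) (chart_map c x) u.
Proof.
move=> ch oS Sx SW hu; have [hl _ _] := ch.
have hW : is_deriv (chart_map c @` (chart_dom c `&` f @^-1` chart_dom d))
    (chart_map d \o f \o chart_inv c) (chart_map c x) u.
  apply: is_deriv_nbhs oS _ Sx hu => z /(chart_imageE _ _ ch)[cz _].
  exact: chart_image_half.
split=> //; apply: xget_unique => // v hv.
by apply: (is_deriv_unique hl oS Sx (is_deriv_sub SW hv) hu).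
Qed.

End ChartImages.

Section ManifoldTopology.
Context {R : realType} {p : option nat}.
Implicit Types X : manifold R p.

Lemma atlas_is_chart X (c : prechart R X) : atlas c -> is_chart c.
Proof. exact: (atlas_chart (atlasP X)). Qed.

Lemma transition_open X (c d : prechart R X) : atlas c -> atlas d ->
  rel_open (chart_half c) (chart_map c @` (chart_dom c `&` chart_dom d)).
Proof. by move=> ca da; have [[]] := atlas_compat (atlasP X) ca da. Qed.

Lemma transition_Cp X (c d : prechart R X) : atlas c -> atlas d ->
  Cp_on p (chart_map c @` (chart_dom c `&` chart_dom d))
    (chart_map d \o chart_inv c).
Proof. by move=> ca da; have [[]] := atlas_compat (atlasP X) ca da. Qed.

Lemma mopenP X (V : set X) : mopen V <-> forall c, atlas c ->
  rel_open (chart_half c) (chart_map c @` (chart_dom c `&` V)).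
Proof. by split=> h c ca; have := h c ca; rewrite setIC. Qed.

Lemma mopen_dom X (c : prechart R X) : atlas c -> mopen (chart_dom c).
Proof. by move=> ca; apply/mopenP => d da; exact: transition_open. Qed.

Lemma mopenI X (V V' : set X) : mopen V -> mopen V' -> mopen (V `&` V').
Proof.
move=> /mopenP oV /mopenP oV'; apply/mopenP => c ca.
have ch := atlas_is_chart ca.
rewrite (_ : _ @` _ = (chart_map c @` (chart_dom c `&` V)) `&`
  (chart_map c @` (chart_dom c `&` V'))); first by apply: rel_openI; auto.
apply/seteqP; split=> z.
  by move=> /(chart_imageE _ _ ch)[cz [Vz V'z]]; split; apply/chart_imageE.
move=> [/(chart_imageE _ _ ch)[cz Vz] /(chart_imageE _ _ ch)[_ V'z]].
by apply/chart_imageE.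
Qed.

Lemma mopen_local X (V : set X) :
  (forall x, V x -> exists V1, [/\ mopen V1, V1 x & V1 `<=` V]) -> mopen V.
Proof.
move=> hV; apply/mopenP => c ca; have ch := atlas_is_chart ca.
apply/rel_openP; split=> [z /(chart_imageE _ _ ch)[cz _]|_ [x [cx Vx] <-]].
  exact: chart_image_half.
have [V1 [/mopenP/(_ c ca)/rel_openP[_ oV1] V1x V1V]] := hV x Vx.
have [|d d0 hd] := oV1 (chart_map c x); first by exists x.
exists d => // y hy yd; apply: image_subset (hd y hy yd).
by apply: setIS.
Qed.

Lemma chart_mopen X (c : prechart R X) W : atlas c ->
  rel_open (chart_half c) W -> mopen (chart_dom c `&` chart_map c @^-1` W).
Proof.
move=> ca oW; apply/mopenP => d da; have dh := atlas_is_chart da.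
have ch := atlas_is_chart ca.
rewrite (_ : _ @` _ = chart_map d @` (chart_dom d `&` chart_dom c) `&`
    (chart_map c \o chart_inv d) @^-1` W).
  apply: rel_open_preimage oW _.
  - exact: transition_open.
  - exact: Cp_on_cont (transition_Cp da ca).
  - move=> z /(chart_imageE _ _ dh)[dz cz] /=.
    by apply: chart_image_half => //; exists (chart_inv d z).
apply/seteqP; split=> z.
  by move=> /(chart_imageE _ _ dh)[dz [cz Wz]]; split=> //; apply/chart_imageE.
by move=> [/(chart_imageE _ _ dh)[dz cz] Wz]; apply/chart_imageE.
Qed.

(** This is the continuity of C^p maps. [Cp_map] offers only one suitable pair of charts at each
    point, so openness is checked locally. *)
Lemma Cp_map_preimage X (X' : manifold R p) (f : X -> X') V :
  Cp_map p (@atlas R p X) (@atlas R p X') f -> mopen V -> mopen (f @^-1` V).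
Proof.
move=> hf /mopenP oV; apply: mopen_local => x Vfx.
have [c [d [ca da cx cd fcd]]] := hf x.
have ch := atlas_is_chart ca; have dh := atlas_is_chart da.
exists (chart_dom c `&` chart_map c @^-1` (chart_image c `&`
  (chart_map d \o f \o chart_inv c) @^-1` (chart_map d @` (chart_dom d `&` V)))).
split.
- apply: chart_mopen => //; apply: rel_open_preimage (oV d da) _.
  + by have [] := ch.
  + exact: Cp_on_cont fcd.
  + move=> z cz; apply: chart_image_half => //; exists (f (chart_inv c z)) => //.
    by apply: cd; have [] := chart_imageP ch cz.
- split=> //; split; first by exists x.
  by exists (f x); rewrite /= ?chart_invK//; split=> //; exact: cd.
- move=> y [cy [_ [w [dw Vw]]]] /=; rewrite chart_invK// => wy.
  by rewrite -(chart_invK dh (cd _ cy)) -wy chart_invK.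
Qed.

(** The new chart belongs to the atlas by maximality: its changes with any chart [d] factor through
    [c] and [Phi] or [Psi]. The form may be replaced, as interior points require. *)
Lemma recoordinatize X (c : prechart R X) (E2 : completeNormedModType R)
    (l2 : E2 -> R) W1 (Phi : chart_model c -> E2) Psi :
  atlas c -> half_form l2 -> W1 `<=` chart_image c ->
  rel_open (chart_half c) W1 -> rel_open (halfspace l2) (Phi @` W1) ->
  (forall z, W1 z -> Psi (Phi z) = z) ->
  Cp_on p W1 Phi -> Cp_on p (Phi @` W1) Psi ->
  atlas (Chart l2 (chart_dom c `&` chart_map c @^-1` W1) (Phi \o chart_map c)
    (chart_inv c \o Psi)).
Proof.
move=> ca hl2 W1c oW1 oPW PsiK Phi_cp Psi_cp; have ch := atlas_is_chart ca.
set e := Chart _ _ _ _.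
have e_im V : chart_map e @` (chart_dom e `&` V) =
    Phi @` (W1 `&` chart_map c @` (chart_dom c `&` V)).
  apply/seteqP; split=> y.
    move=> [x [[cx W1x] Vx] <-]; exists (chart_map c x) => //; split=> //.
    by exists x.
  by move=> [z [W1z [x [cx Vx] xz]] <-]; exists x; rewrite /= xz.
have eh : is_chart e.
  split=> //=; first by move=> x [cx W1x]; rewrite PsiK// chart_invK.
  rewrite (_ : chart_image e = Phi @` W1)//.
  rewrite -[chart_image e]/(chart_map e @` chart_dom e) -[chart_dom e]setIT e_im.
  by rewrite setIT; congr (Phi @` _); apply/setIidPl.
apply: (atlas_max (atlasP X)) => // d da; have dh := atlas_is_chart da.
have W1P z : W1 z -> chart_dom c (chart_inv c z) /\ chart_map c (chart_inv c z) = z.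
  by move=> /W1c; exact: chart_imageP.
split; split.
- rewrite e_im (_ : _ @` _ = Phi @` W1 `&`
    Psi @^-1` (chart_map c @` (chart_dom c `&` chart_dom d))).
    apply: rel_open_preimage (transition_open ca da) _ => //.
      exact: Cp_on_cont Psi_cp.
    move=> _ [z W1z <-]; rewrite PsiK//; apply: chart_image_half => //.
    exact: W1c.
  apply/seteqP; split=> y.
    by move=> [z [W1z cz] <-]; split; [exists z|rewrite /preimage/= PsiK].
  by move=> [[z W1z <-]]; rewrite /preimage/= PsiK// => cz; exists z.
- rewrite e_im.
  rewrite (_ : _ \o _ = (chart_map d \o chart_inv c) \o Psi)//.
  apply: Cp_on_comp (transition_Cp ca da); last first.
    by apply: Cp_on_sub Psi_cp; apply: image_subset => z [].
  by move=> _ [z [W1z cz] <-]; rewrite PsiK.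
- rewrite (_ : _ @` _ = chart_map d @` (chart_dom d `&` chart_dom c) `&`
      (chart_map c \o chart_inv d) @^-1` W1).
    apply: rel_open_preimage oW1 _.
    + exact: transition_open.
    + exact: Cp_on_cont (transition_Cp da ca).
    + move=> z /(chart_imageE _ _ dh)[dz cz] /=.
      by apply: chart_image_half => //; exists (chart_inv d z).
  apply/seteqP; split=> z.
    by move=> /(chart_imageE _ _ dh)[dz [cz Wz]]; split=> //; apply/chart_imageE.
  by move=> [/(chart_imageE _ _ dh)[dz cz] Wz]; apply/chart_imageE.
- rewrite (_ : _ \o _ = Phi \o (chart_map c \o chart_inv d))//.
  apply: Cp_on_comp Phi_cp.
    by move=> z /(chart_imageE _ _ dh)[dz [cz Wz]].
  apply: Cp_on_sub (transition_Cp da ca); apply: image_subset.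
  by apply: setIS => x [].
Qed.

End ManifoldTopology.

(** * Derivatives in charts and invariance of the boundary *)

Section ManifoldDerivatives.
Context {R : realType} {p : option nat} (p0 : p <> Some 0%N).
Implicit Types X : manifold R p.

Lemma Cp_map_id X : Cp_map p (@atlas R p X) (@atlas R p X) id.
Proof.
move=> x; have [c [ca cx]] := atlas_cover (atlasP X) x.
exists c, c; split=> //; apply: Cp_on_ext (Cp_on_id p _) => z cz /=.
by have [_ ->] := chart_imageP (atlas_is_chart ca) cz.
Qed.

(** Smoothness is known in the charts supplied by [Cp_map] only; chart changes carry it over to [c]
    and [d] on a smaller neighbourhood of [x]. *)
Lemma deriv_inP X (X' : manifold R p) (f : X -> X') (c : prechart R X)
    (d : prechart R X') x :
  Cp_map p (@atlas R p X) (@atlas R p X') f ->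
  atlas c -> atlas d -> chart_dom c x -> chart_dom d (f x) ->
  is_deriv (chart_map c @` (chart_dom c `&` f @^-1` chart_dom d))
    (chart_map d \o f \o chart_inv c) (chart_map c x) (deriv_in c d f x).
Proof.
move=> hf ca da cx dfx; have ch := atlas_is_chart ca.
have dh := atlas_is_chart da.
have [c0 [d0 [c0a d0a c0x c0d0 hcd]]] := hf x.
have c0h := atlas_is_chart c0a; have d0h := atlas_is_chart d0a.
pose V := chart_dom c0 `&` f @^-1` chart_dom d.
have oV : mopen V.
  apply: mopenI; first exact: mopen_dom.
  by apply: Cp_map_preimage => //; exact: mopen_dom.
pose S := chart_map c @` (chart_dom c `&` V).
have oS : rel_open (chart_half c) S by exact: (mopenP _).1 oV c ca.
have Sx : S (chart_map c x) by exists x.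
have hS : Cp_on p S (chart_map d \o f \o chart_inv c).
  apply: (@Cp_on_ext _ _ _ _ _ ((chart_map d \o chart_inv d0) \o
    ((chart_map d0 \o f \o chart_inv c0) \o (chart_map c0 \o chart_inv c)))).
    move=> z /(chart_imageE _ _ ch)[cz [c0z dz]] /=.
    by rewrite (chart_invK c0h c0z) (chart_invK d0h (c0d0 _ c0z)).
  apply: Cp_on_comp (transition_Cp d0a da).
    move=> z /(chart_imageE _ _ ch)[cz [c0z dz]] /=.
    rewrite (chart_invK c0h c0z); exists (f (chart_inv c z)) => //.
    by split=> //; exact: c0d0.
  apply: Cp_on_comp hcd.
    by move=> z /(chart_imageE _ _ ch)[cz [c0z dz]]; exists (chart_inv c z).
  apply: Cp_on_sub (transition_Cp ca c0a); apply: image_subset.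
  by apply: setIS => y [].
have [h' hh' _] := Cp_on_C1 p0 hS.
have [|-> //] := deriv_in_unique ch oS Sx _ (hh' _ Sx).
by apply: image_subset; apply: setIS => y [].
Qed.

Lemma deriv_in_comp X (X' X'' : manifold R p) (f : X -> X') (g : X' -> X'')
    (c : prechart R X) (d : prechart R X') (e : prechart R X'') x :
  Cp_map p (@atlas R p X) (@atlas R p X') f ->
  Cp_map p (@atlas R p X') (@atlas R p X'') g ->
  atlas c -> atlas d -> atlas e ->
  chart_dom c x -> chart_dom d (f x) -> chart_dom e (g (f x)) ->
  deriv_in c e (g \o f) x = blin_comp (deriv_in d e g (f x)) (deriv_in c d f x).
Proof.
move=> hf hg ca da ea cx dfx egx.
have ch := atlas_is_chart ca; have dh := atlas_is_chart da.
pose V := f @^-1` (chart_dom d `&` g @^-1` chart_dom e).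
have oV : mopen V.
  apply: Cp_map_preimage hf _; apply: mopenI; first exact: mopen_dom.
  by apply: Cp_map_preimage hg _; exact: mopen_dom.
pose S := chart_map c @` (chart_dom c `&` V).
have oS : rel_open (chart_half c) S by exact: (mopenP _).1 oV c ca.
have Sx : S (chart_map c x) by exists x.
have [| |-> //] := @deriv_in_unique _ _ _ c e (g \o f) x S
  (blin_comp (deriv_in d e g (f x)) (deriv_in c d f x)) ch oS Sx.
  by apply: image_subset; apply: setIS => y [].
apply: (@is_deriv_ext _ _ _ _ ((chart_map e \o g \o chart_inv d) \o
  (chart_map d \o f \o chart_inv c))) => //.
  move=> z /(chart_imageE _ _ ch)[cz [dz ez]] /=.
  by rewrite (chart_invK dh dz).
apply: (@is_deriv_comp _ _ _ _ S
  (chart_map d @` (chart_dom d `&` g @^-1` chart_dom e))) => //.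
- move=> z /(chart_imageE _ _ ch)[cz [dz ez]].
  by exists (f (chart_inv c z)).
- apply: is_deriv_sub (deriv_inP hf ca da cx dfx).
  by apply: image_subset; apply: setIS => y [].
- by rewrite /= chart_invK//; exact: deriv_inP.
Qed.

Lemma deriv_in_id X (c : prechart R X) x : atlas c -> chart_dom c x ->
  deriv_in c c id x = blin_id _.
Proof.
move=> ca cx; have ch := atlas_is_chart ca; have [_ _ oc] := ch.
have [|||-> //] := @deriv_in_unique _ _ _ c c id x (chart_image c) (blin_id _) ch oc.
- by exists x.
- by move=> _ [y cy <-]; exists y.
- apply: (@is_deriv_ext _ _ _ _ id); first by exists x.
  2: exact: (is_deriv_blin _ (blin_id _)).
  by move=> z cz /=; have [_ ->] := chart_imageP ch cz.
Qed.

Lemma deriv_in_change X (c d : prechart R X) x v :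
  atlas c -> atlas d -> chart_dom c x -> chart_dom d x ->
  deriv_in d c id x (deriv_in c d id x v) = v.
Proof.
move=> ca da cx dx.
have := @deriv_in_comp X X X id id c d c x (@Cp_map_id X) (@Cp_map_id X)
  ca da ca cx dx cx.
rewrite (_ : id \o id = id)// deriv_in_id// => /(congr1 (fun u => blin_fun u v)).
by move=> /= <-.
Qed.

(** If [x] were interior in [d], all directions would be admissible there. The form of [c] is
    minimal at [x], so it would vanish on the range of the derivative of the chart change, which is
    everything, against the form being nonzero. *)
Lemma boundary_invariant X (c d : prechart R X) x :
  atlas c -> atlas d -> chart_dom c x -> chart_dom d x ->
  chart_form c (chart_map c x) = 0 -> chart_form d (chart_map d x) = 0.
Proof.
move=> ca da cx dx c0; have ch := atlas_is_chart ca.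
have dh := atlas_is_chart da; apply: contrapT => /eqP d_neq0.
have [lc _ _] := ch; case: lc => [[lc [w lw]]|lc1]; last first.
  by move: c0; rewrite lc1 => /eqP; rewrite oner_eq0.
have oS := transition_open da ca; set S := (X in rel_open _ X) in oS.
have Sx : S (chart_map d x) by exists x.
have [hd _ _] := dh.
have d_gt0 : 0 < chart_form d (chart_map d x).
  rewrite lt_neqAle eq_sym d_neq0; apply: (@chart_image_half _ _ d) => //.
  by exists x.
have [r r0 hr] := rel_open_interior hd oS Sx d_gt0.
have hu := deriv_inP (@Cp_map_id X) da ca dx cx.
have ge0 v : 0 <= chart_form c (deriv_in d c id x v).
  apply: (functional_deriv_ge0 lc hu).
  - have v1 : 0 < `|v| + 1 by rewrite ltr_wpDl.
    exists (r / (`|v| + 1)); first by rewrite divr_gt0.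
    move=> t t0; rewrite ltr_pdivlMr// => tr; apply: hr.
    rewrite [_ + t *: v]addrC addrK normrZ gtr0_norm// (le_lt_trans _ tr)//.
    by rewrite ler_wpM2l ?lerDl// ltW.
  - by rewrite /= chart_invK.
  - move=> z /(chart_imageE _ _ dh)[dz cz] /=.
    by apply: (@chart_image_half _ _ c) => //; exists (chart_inv d z).
have := ge0 (deriv_in c d id x w); have := ge0 (- deriv_in c d id x w).
rewrite linearN/= deriv_in_change// (functionalN _ lc) oppr_ge0 => h1 h2.
by move: lw; rewrite eq_le h1 h2.
Qed.

Lemma boundaryP X (c : prechart R X) x : atlas c -> chart_dom c x ->
  boundary X x <-> chart_form c (chart_map c x) = 0.
Proof.
move=> ca cx; split=> [[d [da dx d0]]|c0]; last by exists c.
exact: boundary_invariant da ca dx cx d0.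
Qed.

Lemma chart_atP X (x : X) : atlas (chart_at x) /\ chart_dom (chart_at x) x.
Proof. by rewrite /chart_at; case: cid. Qed.

Lemma dmap_in X (X' : manifold R p) (f : X -> X') (c : prechart R X)
    (d : prechart R X') x v :
  Cp_map p (@atlas R p X) (@atlas R p X') f ->
  atlas c -> atlas d -> chart_dom c x -> chart_dom d (f x) ->
  dmap f x v = deriv_in d (chart_at (f x)) id (f x)
    (deriv_in c d f x (dchart c x v)).
Proof.
move=> hf ca da cx dfx; have [aa ax] := chart_atP x.
have [ba bx] := chart_atP (f x).
rewrite /dmap /dchart.
rewrite (_ : f = id \o (f \o id))//.
rewrite (@deriv_in_comp _ _ _ (f \o id) id (chart_at x) d)//; last exact: Cp_map_id.
by rewrite (@deriv_in_comp _ _ _ id f (chart_at x) c d)//; exact: Cp_map_id.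
Qed.

Lemma dkerE X (X' : manifold R p) (f : X -> X') (c : prechart R X)
    (d : prechart R X') x :
  Cp_map p (@atlas R p X) (@atlas R p X') f ->
  atlas c -> atlas d -> chart_dom c x -> chart_dom d (f x) ->
  dker f x = dchart c x @^-1` [set v | deriv_in c d f x v = 0].
Proof.
move=> hf ca da cx dfx; have [ba bx] := chart_atP (f x).
apply/seteqP; split=> v; rewrite /dker /= (dmap_in v hf ca da cx dfx).
  by move=> h; rewrite -(deriv_in_change (deriv_in c d f x _) da ba dfx bx) h linear0.
by rewrite /preimage /= => ->; rewrite linear0.
Qed.

End ManifoldDerivatives.

(** * Fibres of submersions *)

Section NormalForm.
Context {R : realType} {p : option nat} (p0 : p <> Some 0%N).
Variables (X X' : manifold R p) (f : X -> X').
Hypothesis hf : Cp_map p (@atlas R p X) (@atlas R p X') f.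

(** The normal form of [f] on the whole domain of [c]. Its base point [y] lies in the target, so it
    survives a translation of [c] along the kernel of [S]; [flat_form] places this kernel in the
    half space. *)
Record flat_chart (y : X') (c : prechart R X) (d : prechart R X')
    (S : blin (chart_model c) (chart_model d)) : Prop := FlatChart {
  flat_atlas : atlas c ;
  flat_target : atlas d ;
  flat_point : chart_dom d y ;
  flat_dom : chart_dom c `<=` f @^-1` chart_dom d ;
  flat_eq : forall x, chart_dom c x ->
    chart_map d (f x) = chart_map d y + S (chart_map c x) ;
  flat_surj : forall v, exists u, S u = v ;
  flat_compl : has_closed_complement [set v | S v = 0] ;
  flat_form : chart_form c = cst 1 \/
    forall v, S v = 0 -> chart_form c v = 0 }.

Lemma interior_chart (c : prechart R X) (d : prechart R X') x : atlas c ->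
  chart_dom c x -> chart_dom c `<=` f @^-1` chart_dom d ->
  Cp_on p (chart_image c) (chart_map d \o f \o chart_inv c) ->
  0 < chart_form c (chart_map c x) ->
  exists c1 : prechart R X, [/\ atlas c1, chart_dom c1 x,
    chart_dom c1 `<=` f @^-1` chart_dom d,
    Cp_on p (chart_image c1) (chart_map d \o f \o chart_inv c1) &
    chart_form c1 = cst 1].
Proof.
move=> ca cx cd hcd lx; have ch := atlas_is_chart ca.
pose W1 := chart_image c `&` [set z | 0 < chart_form c z].
have [hl _ oc] := ch.
have int z : W1 z -> exists2 r, 0 < r & forall y, `|y - z| < r -> W1 y.
  move=> [cz lz].
  case: hl => [[lf lv]|l1]; last first.
    have [r r0 hr] := rel_open_interior (or_intror l1) oc cz lz.
    by exists r => // y /hr cy; split=> //; rewrite /= l1.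
  have oL : open [set z | 0 < chart_form c z].
    by apply: (@open_comp _ _ (chart_form c) [set r | 0 < r]) => [w _|];
      [exact: lf.2|exact: open_gt].
  have /nbhs_normP[s /= s0 hs] : nbhs z [set z | 0 < chart_form c z].
    exact: open_nbhs_nbhs.
  have [r r0 hr] := rel_open_interior (or_introl (conj lf lv)) oc cz lz.
  exists (Num.min r s); first by rewrite lt_min r0.
  move=> y; rewrite lt_min => /andP[yr ys]; split; first exact: hr.
  by apply: hs; rewrite /ball_ /= distrC.
have W1c : W1 `<=` chart_image c by move=> z [].
(* [W1] is open in the model space, hence relatively open both in the half space of [c] and in that
   of the new form [1]. *)
have oW (H : set (chart_model c)) : W1 `<=` H -> rel_open H W1.
  move=> WH; apply/rel_openP; split=> // z /int[r r0 hr].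
  by exists r => // y _; exact: hr.
have W1id : (fun z => z) @` W1 = W1 by rewrite image_id.
have := @recoordinatize R p X c _ (cst 1) W1 (fun z => z) (fun z => z) ca.
rewrite W1id => /(_ (or_intror (erefl _)) W1c) h.
eexists; split; first apply: h => //.
- by apply: oW => z /W1c; exact: chart_image_half.
- by apply: oW => z _; exact: ler01.
- exact: Cp_on_id.
- exact: Cp_on_id.
- by split=> //; split=> //; exists x.
- by move=> y [] /cd.
- by apply: Cp_on_sub hcd => _ [y [_ W1y] <-] /=; exact: W1c.
- by [].
Qed.

Theorem submersion_flat (x0 : X) : submersion f x0 ->
  exists (c : prechart R X) (d : prechart R X')
    (S : blin (chart_model c) (chart_model d)),
    [/\ flat_chart (f x0) S, chart_dom c x0 & chart_map c x0 = 0].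
Proof.
move=> [[V [oV Vx0 Vbd]] df_surj df_compl].
(* The final alternative prepares the two cases of [straighten]: a chart without boundary, or a
   boundary point. *)
have [c [d [[ca da] cx0 cd hcd cform]]] : exists (c : prechart R X)
    (d : prechart R X'), [/\ atlas c /\ atlas d, chart_dom c x0,
    chart_dom c `<=` f @^-1` chart_dom d,
    Cp_on p (chart_image c) (chart_map d \o f \o chart_inv c) &
    chart_form c = cst 1 \/ chart_form c (chart_map c x0) = 0].
  have [c [d [ca da cx0 cd hcd]]] := hf x0; have ch := atlas_is_chart ca.
  have [l0|l0] := eqVneq (chart_form c (chart_map c x0)) 0.
    by exists c, d; split=> //; right.
  have [|c1 [c1a c1x c1d hc1 fc1]] := interior_chart ca cx0 cd hcd.
    rewrite lt_neqAle eq_sym l0; apply: (@chart_image_half _ _ c) => //.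
    by exists x0.
  by exists c1, d; split=> //; left.
have ch := atlas_is_chart ca; have dh := atlas_is_chart da.
have dfx0 : chart_dom d (f x0) by exact: cd.
have [ba bx] := chart_atP (f x0); have [aa ax] := chart_atP x0.
pose u := deriv_in c d f x0; pose z0 := chart_map c x0.
have domE : chart_dom c `&` f @^-1` chart_dom d = chart_dom c.
  exact/setIidPl.
have hu0 : is_deriv (chart_image c) (chart_map d \o f \o chart_inv c) z0 u.
  by have := deriv_inP p0 hf ca da cx0 dfx0; rewrite domE.
have u_surj v : exists w, u w = v.
  have : range (dmap f x0) (deriv_in d (chart_at (f x0)) id (f x0) v).
    by rewrite df_surj.
  move=> [w _]; rewrite (dmap_in p0 w hf ca da cx0 dfx0).
  move=> /(congr1 (deriv_in (chart_at (f x0)) d id (f x0))).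
  by rewrite !deriv_in_change// => <-; exists (dchart c x0 w).
have u_compl : has_closed_complement [set w | u w = 0].
  have := @complement_preimage R (tangent x0) (chart_model c) (dchart c x0)
    (deriv_in c (chart_at x0) id x0) (dker f x0)
    (fun x => deriv_in_change p0 x aa ca ax cx0)
    (fun y => deriv_in_change p0 y ca aa cx0 ax) df_compl.
  rewrite (dkerE p0 hf ca da cx0 dfx0) (_ : _ @^-1` _ = [set w | u w = 0])//.
  by apply/seteqP; split=> w; rewrite /preimage/= /dchart deriv_in_change.
(* The domain is also cut down to the neighbourhood on which [f] maps the boundary into the
   boundary. *)
pose W := chart_map c @` (chart_dom c `&` V).
have oW : rel_open (chart_half c) W by exact: (mopenP _).1 oV c ca.
have Wz0 : W z0 by exists x0.
have Wc : W `<=` chart_image c by apply: image_subset => y [].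
have hW := Cp_on_sub Wc hcd; have huW := is_deriv_sub Wc hu0.
have hl : half_form (chart_form c) by case: ch.
have [|W1 [Phi [Psi [[W1W W1z0 oW1 oPW1] PsiK [Phi_cp Psi_cp] [Phi0 uPhi] lker]]]] :=
  @straighten _ _ _ p _ (chart_form d) _ _ _ _ p0 hl oW Wz0 hW huW u_surj u_compl.
  case: cform => [->|l0]; [by left|right].
  have [hl1|l1] := hl; last by move: l0; rewrite l1 => /eqP; rewrite oner_eq0.
  have ge0 z : W z -> 0 <= chart_form d ((chart_map d \o f \o chart_inv c) z).
    move=> /(chart_imageE _ _ ch)[cz Vz]; apply: (@chart_image_half _ _ d) => //.
    by exists (f (chart_inv c z)) => //; apply: cd; case: (chart_imageP ch cz).
  have bd z : W z -> chart_form c z = 0 ->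
      chart_form d ((chart_map d \o f \o chart_inv c) z) = 0.
    move=> /(chart_imageE _ _ ch)[cz Vz] lz.
    have [cy cyz] := chart_imageP ch cz.
    apply/(boundaryP p0 da (cd _ cy)); apply: Vbd; exists (chart_inv c z) => //.
    by split=> //; apply/(boundaryP p0 ca cy); rewrite cyz.
  have [hd|d1] : half_form (chart_form d) by case: dh.
    split; last by split=> //; [exact: hl1.1|exact: hd.1].
    by apply: (boundary_proportional hl oW Wz0 huW u_surj) => //;
      [exact: hl1.1|exact: hl1.2|exact: hd.1|exact: hd.2].
  (* The form of [d] vanishes at the image of the boundary point [x0], so it is not [1]. *)
  by have := bd z0 Wz0 l0; rewrite d1 => /eqP; rewrite oner_eq0.
have W1c := subset_trans W1W Wc.
have e_atlas := recoordinatize ca hl W1c oW1 oPW1 PsiK Phi_cp Psi_cp.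
exists (Chart (chart_form c) (chart_dom c `&` chart_map c @^-1` W1)
  (Phi \o chart_map c) (chart_inv c \o Psi)), d, u; split=> //.
split=> //.
- by move=> y [] /cd.
- move=> y [cy W1y] /=; rewrite uPhi /= /z0 !chart_invK//.
  by rewrite addrC subrK.
Qed.

End NormalForm.

Section FlatCharts.
Context {R : realType} {p : option nat} (p0 : p <> Some 0%N).
Variables (X X' : manifold R p) (f : X -> X') (y : X').
Hypothesis hf : Cp_map p (@atlas R p X) (@atlas R p X') f.
Variables (c : prechart R X) (d : prechart R X').
Variable S : blin (chart_model c) (chart_model d).
Hypothesis fl : flat_chart f y S.

Let ca := flat_atlas fl.
Let ch := atlas_is_chart ca.
Let dh := atlas_is_chart (flat_target fl).
Let half_c : half_form (chart_form c). Proof. by case: ch. Qed.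

Lemma flat_fiber x : chart_dom c x -> f x = y <-> S (chart_map c x) = 0.
Proof.
move=> cx; have fE := flat_eq fl cx; split=> [fxy|Sx].
  by move: fE; rewrite fxy -[LHS]addr0 => /addrI.
rewrite Sx addr0 in fE.
by rewrite -(chart_invK dh (flat_dom fl cx)) fE (chart_invK dh (flat_point fl)).
Qed.

Lemma flat_half k : S k = 0 -> 0 <= chart_form c k.
Proof.
by move=> Sk; case: (flat_form fl) => [->|->//]; exact: ler01.
Qed.

(** Both alternatives of [flat_form] lead to [1]: a form that vanishes on the kernel is replaced by
    [1], and the form [1] restricts to [1]. *)
Lemma flat_restr_half : restr_half (chart_form c) (blin_ker S) = cst 1.
Proof.
rewrite /restr_half; case: asboolP => // h; apply/funext => k.
case: (flat_form fl) => [->//|hk]; exfalso; apply: h => k'.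
exact: hk (cs_valP k').
Qed.

Lemma flat_image_open :
  rel_open setT [set k : cs_type (blin_ker S) | chart_image c (cs_val k)].
Proof.
have [_ _ oc] := ch.
have := @rel_open_preimage R (cs_type (blin_ker S)) (chart_model c) setT
  setT (chart_half c) (chart_image c) (cs_inc (blin_ker S)).
rewrite setTI; apply=> //.
- by exists setT; [exact: openT|rewrite setTI].
- by apply: (@Cp_on_cont _ (Some 0%N)); exact: Cp_on_blin.
- by move=> k _; exact: (flat_half (cs_valP k)).
Qed.

(** Only the trace of [Y] on the chart enters, so the same slice serves for the full fibre, for its
    part in the chart and for the range of [g]. *)
Lemma flat_slice (Y : set X) x : chart_dom c x -> chart_map c x = 0 ->
  chart_dom c `&` Y = chart_dom c `&` f @^-1` [set y] ->
  @slice_chart R p X Y x c (blin_ker S) (cst 1).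
Proof.
move=> cx cx0 cY; split=> //; first exact: flat_compl fl.
have half1 : halfspace (cst 1) = setT :> set (cs_type (blin_ker S)).
  by apply/seteqP; split=> // k _; exact: ler01.
split; last first.
  rewrite half1 (_ : [set _ | _] = [set k | chart_image c (cs_val k)]).
    exact: flat_image_open.
  by apply/seteqP; split=> [k []|k ck].
rewrite cY half1; apply/seteqP; split=> z.
  move=> [x' [cx' /(flat_fiber cx') Sx'] <-]; split; first by exists x'.
  by exists (CsElt (K := blin_ker S) (mem_set Sx')).
move=> [[x' cx' <-] [k _ kz]]; exists x' => //; split=> //.
by apply/(flat_fiber cx'); rewrite -kz; exact: (cs_valP k).
Qed.

Lemma flat_deriv x : chart_dom c x -> deriv_in c d f x = S.
Proof.
move=> cx; have [_ _ oc] := ch.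
have [||| -> //] := @deriv_in_unique R X X' c d f x (chart_image c) S ch oc.
- by exists x.
- by move=> _ [x' cx' <-]; exists x' => //; split=> //; exact: flat_dom fl _ cx'.
- rewrite -[S]addr0.
  apply: (@is_deriv_ext _ _ _ _ (fun z => S z + chart_map d y)); first by exists x.
    move=> _ [x' cx' <-] /=; rewrite chart_invK// addrC.
    by rewrite (flat_eq fl cx').
  by apply: is_derivD; [exact: is_deriv_blin|exact: is_deriv_cst].
Qed.

Lemma flat_dker x : chart_dom c x ->
  dker f x = dchart c x @^-1` (cs_set (blin_ker S)).
Proof.
move=> cx.
by rewrite (dkerE p0 hf ca (flat_target fl) cx (flat_dom fl cx)) flat_deriv.
Qed.

Lemma flat_dchart_dker x : chart_dom c x ->
  dchart c x @` dker f x = blin_ker S.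
Proof.
move=> cx; rewrite flat_dker//; have [aa ax] := chart_atP x.
apply/seteqP; split=> [_ [v Kv <-]//|k Kk].
exists (deriv_in c (chart_at x) id x k).
  by rewrite /preimage/= /dchart deriv_in_change.
by rewrite /dchart deriv_in_change.
Qed.

(** A slice chart must be centred at its own point. Translating by a vector of the kernel alters
    neither the form nor the affine expression of [f], so every point of the fibre in this chart
    gets a centred one. *)
Lemma flat_translate x : chart_dom c x -> f x = y ->
  exists (e : prechart R X) (S' : blin (chart_model e) (chart_model d)),
    [/\ flat_chart f y S', chart_dom e = chart_dom c & chart_map e x = 0].
Proof.
move=> cx /(flat_fiber cx) Sx; set k := chart_map c x in Sx.
have shift z : chart_form c (z - k) = chart_form c z.
  case: (flat_form fl) => [->//|h]; case: half_c => [[lf _]|->//].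
  by rewrite (functionalB _ _ lf) (h _ Sx) subr0.
have [_ _ oc] := ch; have [cH oc'] := (rel_openP _ _).1 oc.
have domE : chart_dom c `&` chart_map c @^-1` chart_image c = chart_dom c.
  by apply/setIidPl => x' cx'; exists x'.
have e_atlas : atlas (Chart (chart_form c)
    (chart_dom c `&` chart_map c @^-1` chart_image c)
    ((fun z => z - k) \o chart_map c) (chart_inv c \o (fun z => z + k))).
  apply: recoordinatize => //.
  - apply/rel_openP; split=> [_ [z cz <-]|_ [z cz <-]].
      by rewrite /halfspace/= shift; exact: cH.
    have [r r0 hr] := oc' z cz; exists r => // w lw wr.
    exists (w + k); last by rewrite addrK.
    apply: hr; last by rewrite (_ : w + k - z = w - (z - k))//; zmod.
    by rewrite /chart_half /halfspace /= -shift addrK.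
  - by move=> z _; rewrite subrK.
  - by apply: Cp_onD; [exact: Cp_on_id|exact: Cp_on_cst].
  - by apply: Cp_onD; [exact: Cp_on_id|exact: Cp_on_cst].
exists (Chart (chart_form c) (chart_dom c `&` chart_map c @^-1` chart_image c)
    ((fun z => z - k) \o chart_map c) (chart_inv c \o (fun z => z + k))), S.
split=> //=; last by rewrite subrr.
split=> //; first exact: flat_target fl.
- exact: flat_point fl.
- by move=> x' [/(flat_dom fl)].
- by move=> x' [cx' _] /=; rewrite (linearB S)/= Sx subr0; exact: flat_eq fl _ cx'.
- exact: flat_surj fl.
- exact: flat_compl fl.
- exact: flat_form fl.
Qed.

End FlatCharts.

(** * Charts of submanifolds *)

Section SubmanifoldCharts.
Context {R : realType} {p : option nat} (p0 : p <> Some 0%N).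
Variables (X : manifold R p) (Y : set X).

Section OneChart.
Variables (c : prechart R X) (F : csubspace (chart_model c)).
Variables (mu : cs_type F -> R) (phi : Y -> cs_type F) (psi : cs_type F -> Y).
Let D := Chart mu [set z : Y | chart_dom c (set_val z)] phi psi.
Hypotheses (ca : atlas c) (Dh : is_chart D).
Hypothesis phiE : forall z : Y, chart_dom c (set_val z) ->
  cs_val (phi z) = chart_map c (set_val z).

Lemma sub_chart_inv k : chart_image D k ->
  [/\ chart_image c (cs_val k), chart_dom c (set_val (psi k)) &
    set_val (psi k) = chart_inv c (cs_val k)].
Proof.
move=> [z cz <-] /=; have := chart_invK Dh cz => /= ->.
rewrite phiE// chart_invK//; last exact: atlas_is_chart.
by split=> //; exists (set_val z).
Qed.

Lemma sub_chart_open (V : set X) : mopen V ->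
  rel_open (halfspace mu) (phi @` (chart_dom D `&` set_val @^-1` V)).
Proof.
move=> /mopenP/(_ c ca) oV; have [_ _ oD] := Dh.
have ch := atlas_is_chart ca.
rewrite (_ : _ @` _ = chart_image D `&`
    cs_inc F @^-1` (chart_map c @` (chart_dom c `&` V))).
  apply: rel_open_preimage oD _ oV _.
    by apply: (@Cp_on_cont _ (Some 0%N)); exact: Cp_on_blin.
  by move=> k /sub_chart_inv[ck _ _]; exact: chart_image_half.
apply/seteqP; split=> k.
  move=> [z [cz Vz] <-]; split; first by exists z.
  by exists (set_val z) => //=; rewrite phiE.
move=> [Dk /(chart_imageE _ _ ch)[_ /= Vk]].
have [ck cpsi psiE] := sub_chart_inv Dk; exists (psi k).
  by split=> //; rewrite /preimage/= psiE.
by case: Dk => z cz <-; have := chart_invK Dh cz => /= ->.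
Qed.

(** In these charts the inclusion of [Y] into [X] is the inclusion of [F] followed by a change of
    charts of [X]. *)
Lemma sub_chart_deriv (a : prechart R X) (z : Y) : atlas a ->
  chart_dom c (set_val z) -> chart_dom a (set_val z) ->
  deriv_in D a set_val z =
    blin_comp (deriv_in c a id (set_val z)) (cs_inc F) /\
  is_deriv (phi @` (chart_dom D `&` set_val @^-1` chart_dom a))
    (chart_map a \o set_val \o psi) (phi z) (deriv_in D a set_val z).
Proof.
move=> aa cz az; have ch := atlas_is_chart ca.
have oS := sub_chart_open (mopen_dom aa).
set S := (X in rel_open _ X) in oS.
have Sz : S (phi z) by exists z.
have [| |h1 h2] := @deriv_in_unique _ _ _ D a set_val z S
    (blin_comp (deriv_in c a id (set_val z)) (cs_inc F)) Dh oS Sz.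
- by [].
- apply: (@is_deriv_ext _ _ _ _ ((chart_map a \o id \o chart_inv c) \o cs_inc F)) => //.
    move=> _ [w [cw aw] <-] /=; rewrite (phiE cw) chart_invK//.
    by have := chart_invK Dh cw => /= ->.
  apply: (@is_deriv_comp _ _ _ _ S
    (chart_map c @` (chart_dom c `&` id @^-1` chart_dom a))) => //.
  + move=> _ [w [cw aw] <-] /=; exists (set_val w) => //.
    by rewrite phiE.
  + exact: (is_deriv_blin _ (cs_inc F)).
  + by rewrite /= phiE//; apply: deriv_inP => //; exact: Cp_map_id.
by split; rewrite h1//; exact: h2.
Qed.

End OneChart.

(** The change is C^p as a map into the ambient model space; the bounded projection onto the
    complemented subspace [F2] makes it C^p as a map into [F2]. *)
Lemma sub_charts_compatible (D1 D2 : prechart R Y) :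
  sub_charts Y D1 -> sub_charts Y D2 -> compatible p D1 D2.
Proof.
suff half (E1 E2 : prechart R Y) : sub_charts Y E1 -> sub_charts Y E2 ->
    Cp_change p E1 E2 by move=> h1 h2; split; exact: half.
move=> [E1h [_ [c1 [F1 [mu1 [phi1 [psi1 [_ [c1a _ _ _ _] phi1E E1E]]]]]]]].
move=> [E2h [_ [c2 [F2 [mu2 [phi2 [psi2 [_ [c2a _ _ F2c _] phi2E E2E]]]]]]]].
subst E1 E2; have c1h := atlas_is_chart c1a.
split; first exact: (sub_chart_open c1a E1h phi1E (mopen_dom c2a)).
have [P PK] := complement_projection F2c.
apply: (@Cp_on_ext _ _ _ _ _
    (P \o ((chart_map c2 \o chart_inv c1) \o cs_inc F1))).
  move=> _ [z [c1z c2z] <-] /=; have := chart_invK E1h c1z => /= ->.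
  by rewrite phi1E// chart_invK// -phi2E// PK.
apply: (@Cp_on_comp _ _ _ _ _ _ setT) => //; last exact: Cp_on_blin.
apply: Cp_on_comp (transition_Cp c1a c2a); last exact: (Cp_on_blin _ _ (cs_inc F1)).
by move=> _ [z [c1z c2z] <-] /=; exists (set_val z) => //; rewrite phi1E.
Qed.

Lemma sub_charts_sub_atlas (D : prechart R Y) : sub_charts Y D -> sub_atlas Y D.
Proof.
by move=> hD; split; [case: hD|move=> d; exact: sub_charts_compatible].
Qed.

Lemma slice_sub_chart y (c : prechart R X) (F : csubspace (chart_model c))
    (mu : cs_type F -> R) : Y y -> half_form mu -> @slice_chart R p X Y y c F mu ->
  exists phi psi,
    sub_charts Y (Chart mu [set z : Y | chart_dom c (set_val z)] phi psi) /\
    forall z : Y, chart_dom c (set_val z) ->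
      cs_val (phi z) = chart_map c (set_val z).
Proof.
move=> Yy hmu hs; have [ca cy cy0 Fc [imE oD]] := hs.
have ch := atlas_is_chart ca; have [P PK] := complement_projection Fc.
(* The projection makes [phi] total; where it matters the chart already takes its values in [F], and
   [P] leaves them unchanged. *)
pose phi (z : Y) : cs_type F := P (chart_map c (set_val z)).
pose z0 : Y := exist _ y (mem_set Yy).
have /choice[psi psiE] : forall k : cs_type F, exists z : Y, forall w : Y,
    set_val w = chart_inv c (cs_val k) -> z = w.
  move=> k; have [[w wk]|nw] := pselect (exists w : Y,
      set_val w = chart_inv c (cs_val k)).
    by exists w => w' w'k; apply: val_inj; exact: etrans wk (esym w'k).
  by exists z0 => w wk; exfalso; apply: nw; exists w.
have YP (z : Y) : Y (set_val z) by exact: set_valP.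
have phiE z : chart_dom c (set_val z) -> cs_val (phi z) = chart_map c (set_val z).
  move=> cz; have : (chart_image c `&` @cs_val _ _ F @` halfspace mu)
      (chart_map c (set_val z)) by rewrite -imE; exists (set_val z).
  by move=> [_ [k _ kz]]; rewrite /phi -kz PK.
exists phi, psi; split=> //; split; last first.
  by exists y, c, F, mu, phi, psi.
split=> //=.
- by move=> z cz; apply: psiE; rewrite phiE// chart_invK.
- rewrite /chart_half /= (_ : chart_image
      (Chart mu [set z : Y | chart_dom c (set_val z)] phi psi) =
    [set k | chart_image c (cs_val k) /\ halfspace mu k])//.
  apply/seteqP; split=> [_ [z cz <-]|k [ck muk]].
    have : (chart_image c `&` @cs_val _ _ F @` halfspace mu)
        (chart_map c (set_val z)) by rewrite -imE; exists (set_val z).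
    move=> [_ [k muk kz]]; rewrite /= /phi -kz PK; split=> //.
    by rewrite kz; exists (set_val z).
  have : (chart_image c `&` @cs_val _ _ F @` halfspace mu) (cs_val k).
    by split=> //; exists k.
  rewrite -imE => -[x [cx Yx] xk]; exists (exist _ x (mem_set Yx)) => //=.
  by rewrite /phi /= xk PK.
Qed.

End SubmanifoldCharts.

Section OpenSubsets.
Context {R : realType} (p : option nat) {E : completeNormedModType R}.
Variables (l : E -> R) (W : set E).

(** Generating charts can differ only in the values of the inverse outside [W], so every change is
    the identity on [W]. *)
Lemma open_charts_compatible (d1 d2 : prechart R W) :
  open_charts l W d1 -> open_charts l W d2 -> compatible p d1 d2.
Proof.
suff half (e1 e2 : prechart R W) : open_charts l W e1 -> open_charts l W e2 ->
    Cp_change p e1 e2 by move=> h1 h2; split; exact: half.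
move=> [eh [psi eE]] [_ [psi' e'E]]; subst e1 e2.
have [_ _ oW] := eh; split; first by rewrite /= setIT; exact: oW.
apply: Cp_on_ext (Cp_on_id p _) => _ [k _ <-] /=.
by have := chart_invK eh (I : chart_dom (Chart l setT set_val psi) k) => /= ->.
Qed.

Lemma open_chart_exists w : half_form l -> rel_open (halfspace l) W -> W w ->
  exists psi, open_charts l W (Chart l setT set_val psi).
Proof.
move=> hl oW Ww.
have /choice[psi psiE] : forall x : E, exists k : W, W x -> set_val k = x.
  move=> x; have [Wx|nWx] := pselect (W x).
    by exists (exist _ x (mem_set Wx)).
  by exists (exist _ w (mem_set Ww)).
exists psi; split; last by exists psi.
split=> //= [k _|]; first by apply: val_inj; apply: psiE; exact: set_valP.
rewrite (_ : chart_image (Chart l setT set_val psi) = W)//.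
apply/seteqP; split=> [_ [k _ <-]|x Wx].
  exact: set_valP.
by exists (exist _ x (mem_set Wx)).
Qed.

End OpenSubsets.

(** * The fibre: submanifold structure, tangent space, embedding *)

Section FlatFiber.
Context {R : realType} {p : option nat} (p0 : p <> Some 0%N).
Variables (X X' : manifold R p) (f : X -> X') (y : X').
Hypothesis hf : Cp_map p (@atlas R p X) (@atlas R p X') f.

Lemma flat_submanifold (c : prechart R X) (d : prechart R X')
    (S : blin (chart_model c) (chart_model d)) : flat_chart f y S ->
  submanifold (chart_dom c `&` f @^-1` [set y]).
Proof.
move=> fl x [cx fx]; have [e [S' [fl' eE ex]]] := flat_translate fl cx fx.
exists e, (blin_ker S'), (cst 1); split; first by right.
apply: (flat_slice fl') => //; first by rewrite eE.
by rewrite eE setIA setIid.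
Qed.

Lemma fiber_submanifold : (forall x, f x = y -> submersion f x) ->
  submanifold (f @^-1` [set y]).
Proof.
move=> hs x fx; have [c [d [S [fl cx cx0]]]] := submersion_flat p0 hf (hs x fx).
rewrite fx in fl.
exists c, (blin_ker S), (cst 1); split; first by right.
exact: (flat_slice fl).
Qed.

(** Kernel vectors are tangent by a slice chart centred at [x]. Conversely, [f] is constant on the
    fibre, so the chain rule in an arbitrary submanifold chart annihilates tangent vectors. *)
Lemma flat_sub_tangent (c : prechart R X) (d : prechart R X')
    (S : blin (chart_model c) (chart_model d)) x : flat_chart f y S ->
  chart_dom c x -> f x = y -> sub_tangent (f @^-1` [set y]) x = dker f x.
Proof.
move=> fl cx fx; have [aa ax] := chart_atP x; have [ba bx] := chart_atP (f x).
have fY (z : f @^-1` [set y]) : f (set_val z) = y by exact: (set_valP z).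
apply/seteqP; split=> v; last first.
  have [e [S' [fl' eE ex0]]] := flat_translate fl cx fx.
  have ex : chart_dom e x by rewrite eE.
  have ea := flat_atlas fl'.
  rewrite (flat_dker p0 hf fl' ex) => Kv.
  have [phi [psi [hD phiE]]] := slice_sub_chart (Y := f @^-1` [set y]) fx
    (or_intror (erefl _)) (flat_slice fl' ex ex0 (erefl _)).
  pose z : f @^-1` [set y] := exist _ x (mem_set (fx : (f @^-1` [set y]) x)).
  exists (Chart (cst 1) [set z | chart_dom e (set_val z)] phi psi), z.
  split=> //.
  have [-> _] := @sub_chart_deriv R p p0 X (f @^-1` [set y]) e (blin_ker S')
    (cst 1) phi psi ea hD.1 phiE _ z aa ex ax.
  have [k kE] := cs_val_surj Kv.
  by exists k => //=; rewrite kE /dchart deriv_in_change.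
move=> [D [z [hD Dz zx [k _ <-]]]] {v}.
case: hD => [Dh [_ [e [F [mu [phi [psi [_ [ea _ _ _ _] phiE DE]]]]]]]].
subst D x; have [_ hu] := sub_chart_deriv p0 ea Dh phiE aa Dz ax.
set u := deriv_in _ _ _ _ in hu *.
have oS := sub_chart_open ea Dh phiE (mopen_dom aa).
set T := (X in rel_open _ X) in oS.
have Tz : T (phi z) by exists z.
have [hmu _ _] := Dh; have ah := atlas_is_chart aa.
have psiK w : chart_dom e (set_val w) -> psi (phi w) = w by exact: (chart_invK Dh).
(* The constant map thus has the derivative [dmap f] after [u] as well as the derivative 0, and
   uniqueness in the chart [D] equates them. *)
have hc : is_deriv T (cst (chart_map (chart_at (f (set_val z))) y)) (phi z)
    (blin_comp (dmap f (set_val z)) u).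
  apply: (@is_deriv_ext _ _ _ _
    ((chart_map (chart_at (f (set_val z))) \o f \o
      chart_inv (chart_at (set_val z))) \o
     (chart_map (chart_at (set_val z)) \o set_val \o psi))) => //.
    by move=> _ [w [ew aw] <-] /=; rewrite psiK// (chart_invK ah aw) (fY w).
  apply: (is_deriv_comp (V := chart_map (chart_at (set_val z)) @`
      (chart_dom (chart_at (set_val z)) `&`
       f @^-1` chart_dom (chart_at (f (set_val z))))) Tz _ hu).
    move=> _ [w [ew aw] <-] /=; rewrite psiK//; exists (set_val w) => //.
    by split=> //=; rewrite (etrans (fY w) (esym (fY z))).
  by rewrite /= psiK//; exact: (deriv_inP p0 hf aa ba ax bx).
have := is_deriv_unique hmu oS Tz hc (is_deriv_cst _ _ _).
by move=> /(congr1 (fun u0 => blin_fun u0 k)).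
Qed.

Section FlatEmbedding.
Variables (c : prechart R X) (d : prechart R X').
Variables (S : blin (chart_model c) (chart_model d)) (x0 : X).
Hypotheses (fl : flat_chart f y S) (cx0 : chart_dom c x0).
Hypotheses (cx00 : chart_map c x0 = 0) (fx0 : f x0 = y).
Let K := blin_ker S.
Let W : set (cs_type K) := [set k | chart_image c (cs_val k)].
Let g : W -> X := fun k => chart_inv c (cs_val (set_val k)).
Let ch := atlas_is_chart (flat_atlas fl).

Let gP (k : W) : chart_dom c (g k) /\ chart_map c (g k) = cs_val (set_val k).
Proof. by apply: chart_imageP => //; exact: (set_valP k). Qed.

Lemma flat_range : range g = chart_dom c `&` f @^-1` [set y].
Proof.
apply/seteqP; split=> [_ [k _ <-]|x [cx /(flat_fiber fl cx) Sx]].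
  have [ck kE] := gP k; split=> //; apply/(flat_fiber fl ck).
  by rewrite kE; exact: (cs_valP (set_val k)).
pose k : cs_type K := CsElt (K := K) (mem_set Sx).
have Wk : W k by exists x.
by exists (exist _ k (mem_set Wk)) => //; exact: chart_invK.
Qed.

(** Read in the chart [o] of [W] and the slice chart [D] of the range, [corestr g] and its inverse
    are the identity of [K]; read in [o] and [c], [g] is the inclusion of [K]. *)
Lemma flat_embedding :
  embedding (saturate p (open_charts (cst 1) W)) g.
Proof.
have W0 : W 0 by exists x0.
have half1 : halfspace (cst 1) = setT :> set (cs_type K).
  by apply/seteqP; split=> // k _; exact: ler01.
have [|psi ho] := @open_chart_exists R _ (cst 1) W 0 (or_intror (erefl _)) _ W0.
  by rewrite half1; exact: (flat_image_open fl).
set o := Chart _ _ _ _ in ho.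
have oA : saturate p (open_charts (cst 1) W) o.
  by split; [case: ho|move=> o' ho'; exact: (open_charts_compatible p ho ho')].
have psiK (k : W) : psi (set_val k) = k by exact: (chart_invK ho.1 I).
have gx0 : range g x0 by rewrite flat_range.
have gsub : chart_dom c `&` range g = chart_dom c `&` f @^-1` [set y].
  by rewrite flat_range setIA setIid.
have [phi [psi' [hD phiE]]] := slice_sub_chart gx0 (or_intror (erefl _))
  (flat_slice fl cx0 cx00 gsub).
have DA := sub_charts_sub_atlas hD.
set D := Chart _ _ _ _ in hD DA.
have psi'K (z : range g) : chart_dom c (set_val z) -> psi' (phi z) = z.
  exact: (chart_invK hD.1).
have phig (k : W) : phi (corestr g k) = set_val k.
  by apply: val_inj => /=; rewrite phiE /=; have [] := gP k.
have gdom (z : range g) : chart_dom c (set_val z).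
  by have [k _ gk] := set_valP z; rewrite /set_val /= -gk; exact: (gP k).1.
split.
- move=> k; exists o, c; split=> //; first exact: flat_atlas fl.
    by move=> k' _; have [] := gP k'.
  apply: Cp_on_ext (Cp_on_blin p _ (cs_inc K)) => _ [k' _ <-] /=.
  by rewrite psiK; have [_ ->] := gP k'.
- by rewrite flat_range; exact: (flat_submanifold fl).
(* The inverse is obtained by choice from surjectivity; [phig] shows that it is also a left
   inverse. *)
- have /choice[h hE] : forall z : range g, exists k : W, corestr g k = z.
    move=> z; have [k _ gk] := set_valP z; exists k.
    by apply: val_inj; exact: gk.
  split.
    move=> k; exists o, D; split=> //=.
      by move=> k' _; exact: (gP k').1.
    apply: Cp_on_ext (Cp_on_id p _) => _ [k' _ <-] /=.
    by rewrite psiK phig.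
  exists h; split=> //.
    move=> k; have := phig (h (corestr g k)); rewrite hE phig => hk.
    by apply: val_inj; exact: esym hk.
  move=> z; exists D, o; split=> //=.
  apply: Cp_on_ext (Cp_on_id p _) => _ [z' cz' <-] /=.
  by rewrite psi'K// -phig hE.
Qed.

End FlatEmbedding.

End FlatFiber.

Theorem theorem2 (R : realType) (p : option nat) (hp : p <> Some 0%N)
    (X X' : manifold R p) (f : X -> X')
    (hf : Cp_map p (@atlas R p X) (@atlas R p X') f)
    (x0' : X') (x0 : X) (hx0 : f x0 = x0') :
  (submersion f x0 ->
   exists c : prechart R X,
     [/\ atlas c, chart_dom c x0, chart_map c x0 = 0 &
       exists K : csubspace (chart_model c),
         let W : set (cs_type K) := [set k | chart_image c (cs_val k)] in
         let g : W -> X := fun k => chart_inv c (cs_val (set_val k)) in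
         let N : set X :=
           chart_dom c `&` chart_map c @^-1` (chart_image c `&` K) in
         [/\ dchart c x0 @` dker f x0 = K :> set (chart_model c),
             has_closed_complement K,
             rel_open [set k : cs_type K | chart_half c (cs_val k)] W,
             [/\ range g = N,
                 submanifold N &
                 embedding
                   (saturate p (open_charts (restr_half (chart_form c) K) W))
                   g] &
             N = chart_dom c `&` f @^-1` [set x0'] /\
             forall x, (chart_dom c `&` f @^-1` [set x0']) x ->
               sub_tangent (f @^-1` [set x0']) x = dker f x /\
               dker f x = dchart c x @^-1` K]])
  /\
  ((forall x, (f @^-1` [set x0']) x ->
      maps_boundary_near f x /\ submersion f x) ->
   submanifold (f @^-1` [set x0'])).
Proof.
split=> [sf|hs]; last first.
  by apply: fiber_submanifold => // x fx; exact: (hs x fx).2.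
have [c [d [S [fl cx0 cx00]]]] := submersion_flat hp hf sf.
rewrite hx0 in fl; have ca := flat_atlas fl; have ch := atlas_is_chart ca.
exists c; split=> //; exists (blin_ker S) => W g N.
(* The affine normal form identifies the trace of the kernel in the chart with that of the fibre,
   which transfers all claims about [N] to the fibre. *)
have NE : N = chart_dom c `&` f @^-1` [set x0'].
  apply/seteqP; split=> x [cx hx]; split=> //.
    by apply/(flat_fiber fl cx); exact: hx.2.
  by split; [exists x|exact/(flat_fiber fl cx)].
split.
- exact: (flat_dchart_dker hp hf fl).
- exact: flat_compl fl.
- rewrite (_ : [set k : cs_type (blin_ker S) | _] = setT).
    exact: (flat_image_open fl).
  by apply/seteqP; split=> // k _; exact: (flat_half fl (cs_valP k)).
- split; first by rewrite NE; exact: (flat_range fl).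
    by rewrite NE; exact: (flat_submanifold fl).
  by rewrite (flat_restr_half fl); exact: (flat_embedding fl cx0 cx00 hx0).
- split=> // x [cx fx]; split; first exact: (flat_sub_tangent hp hf fl cx fx).
  exact: (flat_dker hp hf fl cx).
Qed.
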